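(* Let $Y\in\Omega_n^r$ be a random simplicial complex with respect to $\mathbb{P}_{r,\mathfrak p}$, where $\mathfrak p=(p_0,p_1,\dots,p_r)$, $p_i=n^{-\alpha_i}$, and $\alpha=\alpha(n)=(\alpha_0,\dots,\alpha_r)\in\mathbb{R}_+^{r+1}$ is a sequence of vectors converging to a vector $\alpha_\ast\in\mathfrak{D}_k$, where $2\le k\le r$. Then for every $0<j\le k-1$ one has $$H_j(Y;\mathbb{Q})=0,\quad\text{a.a.s.}$$
   Context: Model. Fix an integer $r$. Let $\Delta_n$ be the simplex with vertex set $\{1,\dots,n\}$, viewed as an abstract simplicial complex. For a subcomplex $Y\subset\Delta_n$, $f_i(Y)$ is the number of $i$-dimensional simplexes of $Y$, and $e_i(Y)$ is the number of $i$-dimensional external faces of $Y$, i.e. $i$-simplexes $\sigma\subset\Delta_n$ with $\sigma\not\subset Y$ but $\partial\sigma\subset Y$ (for $i=0$: vertices not in $Y$). $\Omega_n^r$ is the set of all subcomplexes $Y\subset\Delta_n$ with $\dim Y\le r$ (including the empty one). For $\mathfrak p=(p_0,\dots,p_r)$ with $0\le p_i\le 1$ the probability measure on $\Omega_n^r$ is $$\mathbb{P}_{r,\mathfrak p}(Y)=\prod_{i=0}^r p_i^{f_i(Y)}\cdot\prod_{i=0}^r(1-p_i)^{e_i(Y)},\qquad 0^0=1.$$ Notation. $\mathbb{R}_+=[0,\infty)$. For $\alpha=(\alpha_0,\dots,\alpha_r)$ and $k=0,\dots,r$ put $\psi_k(\alpha)=\sum_{i=0}^r\binom{k}{i}\alpha_i$,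 with $\binom{k}{i}=0$ for $i>k$ and $\binom00=1$. Domains: $\mathfrak{D}_k=\{\alpha\in\mathbb{R}^{r+1}_+:\psi_k(\alpha)<1<\psi_{k+1}(\alpha)\}$ for $0\le k\le r-1$, and $\mathfrak{D}_r=\{\alpha\in\mathbb{R}^{r+1}_+:\psi_r(\alpha)<1\}$. ''A.a.s.'' means with probability tending to $1$ as $n\to\infty$. *)

(* Defs.v *)
From HB Require Import structures.
From mathcomp Require Import all_boot all_order all_algebra.
From mathcomp Require Import ring_quotient.
From mathcomp Require Import all_classical all_reals all_analysis.

Set Implicit Arguments.
Unset Strict Implicit.
Unset Printing Implicit Defensive.

Import Order.TTheory GRing.Theory Num.Theory.
Import numFieldNormedType.Exports.

Local Open Scope classical_set_scope.
Local Open Scope ring_scope.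

(* A subcomplex of the simplex on 'I_n is the set of its (nonempty) simplexes;
   a simplex of dimension i is a vertex set of cardinality i.+1.  The empty
   complex is [set0]. *)
Definition subcomplex (n : nat) (Y : {set {set 'I_n}}) : bool :=
  (finset.set0 \notin Y) &&
  [forall s : {set 'I_n} in Y, forall t : {set 'I_n},
     (t != finset.set0) && (t \subset s) ==> (t \in Y)].

Definition Omega (n r : nat) : {set {set {set 'I_n}}} :=
  [set Y : {set {set 'I_n}} |
    subcomplex Y && [forall s : {set 'I_n} in Y, #|s| <= r.+1]%N]%SET.

Definition faces (n : nat) (Y : {set {set 'I_n}}) (i : nat) : {set {set 'I_n}} :=
  [set s : {set 'I_n} in Y | #|s| == i.+1]%SET.

Definition external_faces (n : nat) (Y : {set {set 'I_n}}) (i : nat) :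
    {set {set 'I_n}} :=
  [set s : {set 'I_n} | [&& #|s| == i.+1, s \notin Y &
     [forall t : {set 'I_n}, (t != finset.set0) && (t \proper s) ==> (t \in Y)]]]%SET.

Section Homology.
Variables (n : nat) (Y : {set {set 'I_n}}).

Definition face (i : nat) : finType := {s : {set 'I_n} | s \in faces Y i}.

(* Simplexes are oriented by the order of 'I_n. *)
Definition chain (i : nat) : vectType rat := {ffun face i -> rat^o}.

Definition incidence (s t : {set 'I_n}) : rat :=
  \sum_(v in s | (s :\ v)%SET == t) (-1) ^+ #|[set u in s | (u < v)%N]%SET|.

Definition boundary_fun (i j : nat) (c : chain i) : chain j :=
  [ffun t : face j => \sum_(s : face i) incidence (val s) (val t) * c s].

Fact boundary_fun_is_linear i j : linear (@boundary_fun i j).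
Proof.
move=> a c d; apply/ffunP=> t; rewrite !ffunE /GRing.scale /= mulr_sumr -big_split.
by apply: eq_bigr => s _; rewrite !ffunE mulrDr mulrCA.
Qed.

HB.instance Definition _ i j :=
  GRing.isLinear.Build rat (chain i) (chain j) _ (@boundary_fun i j)
    (@boundary_fun_is_linear i j).

(* This is the simplicial boundary when i = j.+1, and 0 otherwise: [incidence]
   vanishes unless its arguments have cardinalities m.+1 and m. *)
Definition boundary (i j : nat) : 'Hom(chain i, chain j) :=
  linfun (@boundary_fun i j).

(* For j = 0 the map below is [boundary 0 0 = 0], so that every 0-chain is a
   cycle: the homology is not reduced. *)
Definition cycles (j : nat) : {vspace chain j} := lker (boundary j j.-1).

Definition boundaries (j : nat) : {vspace chain j} := limg (boundary j.+1 j).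

Definition boundaries_in_cycles (j : nat) : {vspace subvs_of (cycles j)} :=
  (linfun (vsval : subvs_of (cycles j) -> chain j) @^-1: boundaries j)%VS.

(* The additive group of the rational vector space H_j(Y; Q) = Z_j / B_j. *)
Definition homology (j : nat) : zmodType :=
  Quotient.quot (pred_of_vspace (boundaries_in_cycles j) : zmodClosed _).

End Homology.

Section RandomComplex.
Variables (R : realType) (r : nat).

Definition prob (n : nat) (p : 'I_r.+1 -> R) (Y : {set {set 'I_n}}) : R :=
  (\prod_(i < r.+1) p i ^+ #|faces Y i|) *
  (\prod_(i < r.+1) (1 - p i) ^+ #|external_faces Y i|).

Definition Pr (n : nat) (p : 'I_r.+1 -> R) (A : {set {set 'I_n}} -> Prop) : R :=
  \sum_(Y in Omega n r | `[< A Y >]) prob p Y.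

(* [p n] is the parameter vector used on n vertices. *)
Definition aas (p : nat -> 'I_r.+1 -> R)
    (A : forall n : nat, {set {set 'I_n}} -> Prop) : Prop :=
  Pr (p n) (@A n) @[n --> \oo] --> (1 : R).

Definition psi (k : nat) (a : 'rV[R]_r.+1) : R :=
  \sum_(i < r.+1) 'C(k, i)%:R * a ord0 i.

(* For k = r the upper condition disappears. *)
Definition domain (k : nat) : set 'rV[R]_r.+1 :=
  [set a : 'rV[R]_r.+1 | [/\ forall i, 0 <= a ord0 i,
               psi k a < 1 &
               (k < r)%N -> 1 < psi k.+1 a]].

End RandomComplex.

(* Main.v *)
(* Only [psi j.+1 alphastar < 1] matters, and it makes the expected number
   [D = n ^ (1 - psi j.+1 alpha)] of cofaces of a [j]-simplex at least a positive power of [n].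

   Garland's method, unweighted: let [c] be a [j]-chain that is both a cycle and orthogonal to
   the boundaries.  Summing the squares of the cocycle equations over all [j.+1]-simplexes
   gives [\sum_s deg s * c s ^+ 2 = \sum_sigma <c_sigma, A_sigma c_sigma>], where [sigma] runs
   over the simplexes of dimension [j - 1], [A_sigma] is the adjacency matrix of the link graph
   of [sigma] and [c_sigma] is [c] localized at [sigma], which sums to zero because [c] is a
   cycle.  On such functions [A_sigma] may be replaced by its centering [M_sigma], so [c = 0] as
   soon as all degrees are at least [D / 8] and all norms of the [M_sigma] are at most
   [D / (16 * j.+1)].

   The random complex is the largest one inside a random hypergraph with independent faces.
   There the degrees are controlled by Chernoff's bound and the norms by the trace method with
   a fixed high power: a closed walk contributes to [E (\tr (M_sigma ^+ K.*2))] only if it uses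
   each of its edges at least twice, and it has at most one more vertex than edges.  Both
   failure probabilities are [O (D ^- K)], which beats the union bound for [K] large. *)
Require Import Defs.
From HB Require Import structures.
From mathcomp Require Import all_boot all_order all_algebra.
From mathcomp Require Import ring lra ring_quotient boolp reals.

Set Implicit Arguments.
Unset Strict Implicit.
Unset Printing Implicit Defensive.

Import Order.TTheory GRing.Theory Num.Theory.

Local Open Scope ring_scope.

(** * Product measures on sets *)

Section ProductMeasure.
Variables (R : numDomainType) (T : finType) (p : T -> R).
Implicit Types (w A : {set T}) (F G : {set T} -> R).

(** The product Bernoulli law; since [T] is finite, expectations are plain finite sums. *)
Definition weight w : R := \prod_t (if t \in w then p t else 1 - p t).

Definition expect F : R := \sum_w weight w * F w.

Lemma eq_expect F G : F =1 G -> expect F = expect G.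
Proof. by move=> FG; apply: eq_bigr => w _; rewrite FG. Qed.

Lemma expect_sum (I : Type) (s : seq I) (P : pred I) (F : I -> {set T} -> R) :
  expect (fun w => \sum_(i <- s | P i) F i w) =
  \sum_(i <- s | P i) expect (F i).
Proof.
rewrite /expect exchange_big /=; apply: eq_bigr => w _.
by rewrite mulr_sumr.
Qed.

Lemma expectD F G : expect (fun w => F w + G w) = expect F + expect G.
Proof. by rewrite /expect -big_split; apply: eq_bigr => w _; rewrite mulrDr. Qed.

Lemma expectZ c F : expect (fun w => c * F w) = c * expect F.
Proof. by rewrite mulr_sumr; apply: eq_bigr => w _; rewrite mulrCA. Qed.

(** Independence in its basic form: distributing a product of two-term sums yields one term for each
    subset. *)
Lemma expect_prod (f g : T -> R) :
  expect (fun w => \prod_t (if t \in w then f t else g t)) =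
  \prod_t (p t * f t + (1 - p t) * g t).
Proof.
rewrite bigA_distr; apply: eq_bigr => w _; rewrite -big_split /=.
by apply: eq_bigr => t _; case: ifP.
Qed.

Lemma expect1 : expect (fun=> 1) = 1.
Proof.
have := expect_prod (fun=> 1) (fun=> 1).
rewrite (@eq_expect _ (fun=> 1)); last first.
  by move=> w; rewrite big1 // => t _; case: ifP.
by move=> ->; rewrite big1 // => t _; rewrite !mulr1 addrC subrK.
Qed.

Lemma expect_incl A : expect (fun w => (A \subset w)%:R) = \prod_(t in A) p t.
Proof.
rewrite (@eq_expect _ (fun w => \prod_t (if t \in w then 1 else (t \notin A)%:R))).
  rewrite expect_prod [RHS]big_mkcond; apply: eq_bigr => t _.
  by case: (t \in A); rewrite mulr1 ?mulr0 ?addr0 // mulr1 addrC subrK.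
move=> w; case: (boolP (A \subset w)) => [/subsetP Aw|/subsetPn [t tA tw]].
  by rewrite big1 // => t _; case: ifPn => // /(contra (Aw t)) ->.
by rewrite (bigD1 t) //= (negPf tw) tA mul0r.
Qed.

(* Peeling off one factor [a g + b g * 1] enlarges the block [A] on which [w] is prescribed. *)
Lemma expect_incl_blocks (I : eqType) (B : I -> {set T}) (a b : I -> R)
    (s : seq I) A :
  uniq s -> {in s &, forall g h, g != h -> [disjoint B g & B h]} ->
  {in s, forall g, [disjoint A & B g]} ->
  expect (fun w => (A \subset w)%:R *
            \prod_(g <- s) (a g + b g * (B g \subset w)%:R)) =
  \prod_(t in A) p t * \prod_(g <- s) (a g + b g * \prod_(t in B g) p t).
Proof.
elim: s A => [|g s IH] A /=.
  move=> _ _ _; rewrite big_nil mulr1 -expect_incl; apply: eq_expect => w.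
  by rewrite big_nil mulr1.
case/andP=> gs us Bd Ad.
have Bs : {in s &, forall g h, g != h -> [disjoint B g & B h]}.
  by move=> x y xs ys; apply: Bd; rewrite inE ?xs ?ys orbT.
have As : {in s, forall h, [disjoint A & B h]}.
  by move=> h hs; apply: Ad; rewrite inE hs orbT.
have ABs : {in s, forall h, [disjoint A :|: B g & B h]}.
  move=> h hs; rewrite -setI_eq0 setIUl setU_eq0 !setI_eq0 As // Bd ?inE ?eqxx ?hs ?orbT //.
  by apply: contra gs => /eqP ->.
rewrite (@eq_expect _ (fun w =>
  a g * ((A \subset w)%:R * \prod_(g <- s) (a g + b g * (B g \subset w)%:R)) +
  b g * ((A :|: B g \subset w)%:R *
         \prod_(g <- s) (a g + b g * (B g \subset w)%:R)))); last first.
  move=> w; rewrite big_cons subUset -mulnb natrM mulrDl mulrDr mulrCA.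
  by rewrite -!mulrA; congr (_ + _); rewrite [LHS]mulrCA; congr (_ * (_ * _)).
rewrite expectD !expectZ !IH // big_cons.
have -> : \prod_(t in A :|: B g) p t = \prod_(t in A) p t * \prod_(t in B g) p t.
  rewrite -bigU /=; first by apply: eq_bigl => t; rewrite !inE.
  by apply: Ad; rewrite mem_head.
rewrite mulrDl mulrDr; congr (_ + _); first by rewrite mulrCA.
by rewrite -!mulrA mulrCA.
Qed.

(** Disjoint blocks are independent. Every function of an indicator is affine in it, so the factors
    cover all functions of the presence of a block. *)
Lemma expect_blocks (I : eqType) (B : I -> {set T}) (a b : I -> R) (s : seq I) :
  uniq s -> {in s &, forall g h, g != h -> [disjoint B g & B h]} ->
  expect (fun w => \prod_(g <- s) (a g + b g * (B g \subset w)%:R)) =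
  \prod_(g <- s) (a g + b g * \prod_(t in B g) p t).
Proof.
move=> us Bd; have := @expect_incl_blocks _ B a b s set0 us Bd.
rewrite big_set0 mul1r => <-; last by move=> g _; rewrite -setI_eq0 set0I.
by apply: eq_expect => w; rewrite sub0set mul1r.
Qed.

Hypothesis p01 : forall t, 0 <= p t <= 1.

Lemma weight_ge0 w : 0 <= weight w.
Proof.
by apply: prodr_ge0 => t _; have /andP[p0 p1] := p01 t; case: ifP; rewrite ?subr_ge0.
Qed.

Lemma le_expect F G : (forall w, F w <= G w) -> expect F <= expect G.
Proof. by move=> FG; apply: ler_sum => w _; rewrite ler_wpM2l ?weight_ge0. Qed.

End ProductMeasure.

(** * Sums over walks *)

Section Walks.
Variables (R : realFieldType) (I : finType).
Implicit Types (G H : seq I -> R) (M : I -> I -> R) (x y : I) (s : seq I).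

(** Sums over words of length [l], by recursion on the first letter, as in the expansion of a matrix
    power. *)
Fixpoint wsum (l : nat) G : R :=
  if l is l'.+1 then \sum_y wsum l' (fun s => G (y :: s)) else G [::].

Lemma eq_wsum l G H : (forall s, size s = l -> G s = H s) -> wsum l G = wsum l H.
Proof.
elim: l G H => [|l IH] G H GH /=; first exact: GH.
by apply: eq_bigr => y _; apply: IH => s sl; apply: GH; rewrite /= sl.
Qed.

Lemma le_wsum l G H :
  (forall s, size s = l -> G s <= H s) -> wsum l G <= wsum l H.
Proof.
elim: l G H => [|l IH] G H GH /=; first exact: GH.
by apply: ler_sum => y _; apply: IH => s sl; apply: GH; rewrite /= sl.
Qed.

Lemma wsumZ l c G : wsum l (fun s => c * G s) = c * wsum l G.
Proof.
elim: l G => [|l IH] G //=; rewrite mulr_sumr.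
by apply: eq_bigr => y _; rewrite IH.
Qed.

Lemma expect_wsum (T : finType) (p : T -> R) l (G : {set T} -> seq I -> R) :
  expect p (fun w => wsum l (G w)) = wsum l (fun s => expect p (fun w => G w s)).
Proof.
elim: l G => [|l IH] G //=; rewrite expect_sum.
by apply: eq_bigr => y _; rewrite IH.
Qed.

(* Choosing the next letter multiplies the sum by at most [#|A| + 1]: it lies in [A], or it
   is new and its [#|I|] choices are compensated by the extra factor [#|I|^-1]. *)
Lemma wsum_card_aux l (A : {set I}) :
  wsum l (fun s => #|I|%:R^-1 ^+ #|A :|: [set x in s]%SET|) <=
  ((#|A| + l) ^ l)%:R * #|I|%:R^-1 ^+ #|A|.
Proof.
set c := #|I|%:R^-1; have c0 : 0 <= c by rewrite invr_ge0.
elim: l A => [|l IH] A /=.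
  have -> : [set x in [::]]%SET = set0 :> {set I} by apply/setP=> x; rewrite !inE.
  by rewrite setU0 mul1r.
pose b := ((#|A|.+1 + l) ^ l)%:R * c ^+ #|A|.
have b0 : 0 <= b by rewrite mulr_ge0 ?exprn_ge0.
apply: (@le_trans _ _ (\sum_y ((y \in A)%:R * b + c * b))).
  apply: ler_sum => y _.
  have -> : wsum l (fun s => c ^+ #|A :|: [set x in y :: s]%SET|) =
            wsum l (fun s => c ^+ #|(y |: A) :|: [set x in s]%SET|).
    apply: eq_wsum => s _; congr (_ ^+ #|pred_of_set _|); apply/setP=> x.
    by rewrite !inE orbCA orbA.
  apply: (le_trans (IH _)); rewrite cardsU1; case: (y \in A) => /=.
    rewrite mul1r add0n -[leLHS]addr0; apply: lerD; last by rewrite mulr_ge0.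
    rewrite ler_wpM2r ?exprn_ge0 // ler_nat.
    by case: (l) => [|k]; rewrite ?expn0 // leq_exp2r // leq_add2r leqnSn.
  by rewrite mul0r add0r add1n exprS mulrCA.
rewrite big_split /= -mulr_suml -mulr_suml sumr_const.
have -> : \sum_y (y \in A)%:R = #|A|%:R :> R.
  by rewrite -natr_sum -sum1_card [in RHS]big_mkcond; congr _%:R; apply: eq_bigr => y _; case: ifP.
(* For empty [I] the inverse is [0] by convention, and the sum is [0] rather than [1]. *)
have -> : c *+ #|I| = (#|I| != 0)%:R.
  rewrite -[c *+ _]mulr_natl /c; have [->|I0] := eqVneq #|I| 0%N; first by rewrite mulr0n mul0r.
  by rewrite mulfV // pnatr_eq0.
rewrite -mulrDl /b mulrA -!natrD -natrM ler_wpM2r ?exprn_ge0 // ler_nat.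
rewrite addnS expnS -addSn leq_mul2r; apply/orP; right.
by rewrite addSn -addnS leq_add2l; case: eqP.
Qed.

End Walks.

(** * Vertices and edges of a walk *)

Section WalkEdges.
Variables (R : realFieldType) (I : finType).
Implicit Types (G H : seq I -> R) (M : I -> I -> R) (x y : I) (s : seq I).

Fixpoint pathprod M x s : R :=
  if s is y :: s' then M x y * pathprod M y s' else 1.

Fixpoint walk_edges x s : seq {set I} :=
  if s is y :: s' then [set x; y]%SET :: walk_edges y s' else [::].

Lemma size_walk_edges x s : size (walk_edges x s) = size s.
Proof. by elim: s x => //= y s IH x; rewrite IH. Qed.

Lemma walk_edges_sub x s e : e \in walk_edges x s -> {subset e <= x :: s}.
Proof.
elim: s x => //= y s IH x; rewrite inE => /orP[/eqP ->|/IH sub] z.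
  by rewrite !inE => /orP[] ->; rewrite ?orbT.
by move=> /sub zs; rewrite inE zs orbT.
Qed.

(* A vertex met for the first time is reached through a new edge. *)
Lemma card_walk x s :
  (size (undup (x :: s)) <= (size (undup (walk_edges x s))).+1)%N.
Proof.
elim: s x => // y s IH x; rewrite -/([:: x] ++ y :: s) [_ ++ _]/= [undup (x :: _)]/=.
have le : (size (undup (walk_edges y s)) <= size (undup (walk_edges x (y :: s))))%N.
  by rewrite /=; case: ifP => //= _; rewrite ltnW.
case: ifPn => [_|xs]; first by apply: leq_trans (IH y) _; rewrite ltnS.
rewrite [size (_ :: _)]/= ltnS; apply: leq_trans (IH y) _ => /=.
(* Were the first edge used again later, [x] itself would occur later in the walk. *)
case: ifPn => //= /walk_edges_sub/(_ x); rewrite !inE eqxx /= => /(_ isT).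
by move: xs; rewrite inE => /negPf ->.
Qed.

End WalkEdges.

(** * Quadratic forms and traces of powers *)

Section Spectral.
Variable R : realFieldType.

(** Expanding [\sum_i (B * a i - C * b i) ^+ 2] gives [B * (A * B - C ^+ 2)], and [B] can be
    cancelled unless all [b i] vanish. *)
Lemma cauchy_schwarz (I : finType) (a b : I -> R) :
  (\sum_i a i * b i) ^+ 2 <= (\sum_i a i ^+ 2) * (\sum_i b i ^+ 2).
Proof.
set A := \sum_i a i ^+ 2; set B := \sum_i b i ^+ 2; set C := \sum_i a i * b i.
have B0 : 0 <= B by apply: sumr_ge0 => i _; rewrite sqr_ge0.
have : 0 <= B * (A * B - C ^+ 2).
  have -> : B * (A * B - C ^+ 2) = \sum_i (B * a i - C * b i) ^+ 2.
    transitivity (\sum_i (B ^+ 2 * a i ^+ 2 + (- (2 * B * C) * (a i * b i) +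
                           C ^+ 2 * b i ^+ 2))).
      by rewrite !big_split -!mulr_sumr -/A -/B -/C /=; ring.
    by apply: eq_bigr => i _; ring.
  by apply: sumr_ge0 => i _; rewrite sqr_ge0.
have [Bp|B'] := ltP 0 B; first by rewrite pmulr_rge0 // subr_ge0.
have B00 : B = 0 by apply/eqP; rewrite eq_le B0 B'.
have b0 i : b i = 0.
  apply/eqP; rewrite -sqrf_eq0; apply/eqP.
  by move/psumr_eq0P: B00; apply=> // k _; rewrite sqr_ge0.
by move=> _; rewrite B00 mulr0 /C big1 ?expr0n // => i _; rewrite b0 mulr0.
Qed.

Lemma mxtrace_sqr (n : nat) (M : 'M[R]_n) :
  M^T = M -> \tr (M *m M) = \sum_i \sum_j M i j ^+ 2.
Proof.
move=> Ms; apply: eq_bigr => i _; rewrite mxE; apply: eq_bigr => j _.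
by rewrite -[in M j i]Ms mxE expr2.
Qed.

Lemma trmxX (n : nat) (M : 'M[R]_n) k : (M ^+ k)^T = M^T ^+ k.
Proof.
elim: k => [|k IH]; first by rewrite !expr0 trmx1.
by rewrite exprS exprSr -IH; apply: trmx_mul.
Qed.

Definition qform (n : nat) (M : 'M[R]_n) (f : 'I_n -> R) : R :=
  \sum_i f i * \sum_j M i j * f j.

Lemma qform_sqr (n : nat) (M : 'M[R]_n) f :
  M^T = M -> qform (M *m M) f = \sum_i (\sum_j M i j * f j) ^+ 2.
Proof.
move=> Ms.
transitivity (\sum_i \sum_k \sum_j f i * (M i k * (M k j * f j))).
  apply: eq_bigr => i _; rewrite mulr_sumr exchange_big /=; apply: eq_bigr => j _.
  by rewrite mxE mulr_suml mulr_sumr; apply: eq_bigr => k _; rewrite -!mulrA.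
rewrite exchange_big /=; apply: eq_bigr => k _.
rewrite expr2 mulr_suml; apply: eq_bigr => i _.
rewrite mulr_sumr; apply: eq_bigr => j _.
by rewrite -[in M i k]Ms mxE mulrA [f i * _]mulrC.
Qed.

(* Iterating Cauchy-Schwarz bounds the form of [M] by that of [M ^+ 2 ^ a], which is
   controlled by the Frobenius norm of the latter; no eigenvalues are needed. *)
Lemma qform_le_trace (n a : nat) (M : 'M[R]_n) (b : R) (f : 'I_n -> R) :
  M^T = M -> 0 <= b -> \tr (M ^+ (2 ^ a.+1)) <= b ^+ (2 ^ a.+1) ->
  qform M f <= b * \sum_i f i ^+ 2.
Proof.
move=> Ms b0 trb; set N := \sum_i f i ^+ 2.
have N0 : 0 <= N by apply: sumr_ge0 => i _; rewrite sqr_ge0.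
have Mks k : (M ^+ k)^T = M ^+ k by rewrite trmxX Ms.
have MXX k : M ^+ (2 ^ k.+1) = M ^+ (2 ^ k) *m M ^+ (2 ^ k).
  by rewrite expnS mul2n -addnn exprD.
have [Np|N'] := ltP 0 N; last first.
  have N00 : N = 0 by apply/eqP; rewrite eq_le N0 N'.
  have f0 i : f i = 0.
    apply/eqP; rewrite -sqrf_eq0; apply/eqP.
    by move/psumr_eq0P: N00; apply=> // k _; rewrite sqr_ge0.
  by rewrite N00 mulr0 /qform big1 // => i _; rewrite f0 mul0r.
rewrite leNgt; apply/negP => lt.
have step k : qform (M ^+ (2 ^ k)) f ^+ 2 <= N * qform (M ^+ (2 ^ k.+1)) f.
  by rewrite MXX qform_sqr //; exact: cauchy_schwarz.
(* Failure of the bound for [M] would persist under repeated squaring. *)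
have big k : b ^+ (2 ^ k) * N < qform (M ^+ (2 ^ k)) f.
  elim: k => [|k IH]; first by rewrite expn0 !expr1.
  rewrite -(ltr_pM2l Np); apply: lt_le_trans (step k).
  have -> : N * (b ^+ (2 ^ k.+1) * N) = (b ^+ (2 ^ k) * N) ^+ 2.
    by rewrite expnS mulnC exprM; ring.
  by rewrite ltr_pXn2r // nnegrE ?mulr_ge0 ?exprn_ge0 // ltW //
    (le_lt_trans _ IH) // mulr_ge0 ?exprn_ge0.
(* The squared Frobenius norm of a symmetric matrix is the trace of its square, so Cauchy-Schwarz
   applied twice bounds the form at exponent [2 ^ a]. *)
have : qform (M ^+ (2 ^ a)) f ^+ 2 <= N * (N * \tr (M ^+ (2 ^ a.+1))).
  rewrite MXX mxtrace_sqr //; apply: le_trans (cauchy_schwarz _ _) _.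
  rewrite ler_wpM2l // mulrC mulr_suml; apply: ler_sum => i _.
  exact: cauchy_schwarz.
have : (b ^+ (2 ^ a) * N) ^+ 2 < qform (M ^+ (2 ^ a)) f ^+ 2.
  have b0' : 0 <= b ^+ (2 ^ a) * N by rewrite mulr_ge0 ?exprn_ge0.
  by rewrite ltr_pXn2r // nnegrE // ltW // (le_lt_trans b0').
move=> /lt_le_trans h /h; apply/negP; rewrite -leNgt.
have -> : (b ^+ (2 ^ a) * N) ^+ 2 = N * (N * b ^+ (2 ^ a.+1)).
  by rewrite [in RHS]expnS mulnC exprM; ring.
by rewrite !ler_wpM2l.
Qed.

(** Expanding the product turns the trace of a power into a sum over closed walks. *)
Lemma exprmxE (n l : nat) (M : 'M[R]_n) i j :
  (M ^+ l) i j = wsum l (fun s => (last i s == j)%:R * pathprod M i s).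
Proof.
elim: l i => [|l IH] i; first by rewrite expr0 mxE /= mulr1.
rewrite exprS mxE; apply: eq_bigr => k _; rewrite IH -wsumZ.
by apply: eq_wsum => s _ /=; rewrite mulrCA.
Qed.

End Spectral.

(** * Random links *)

Section LinkMatrix.
Variables (R : realFieldType) (n : nat) (pc : nat -> R).
Hypothesis pc01 : forall i, 0 <= pc i <= 1.
Implicit Types (g h t e : {set 'I_n}) (w : {set {set 'I_n}}).

(** The probability that [t :|: g] is a hyperedge for all [t \subset sigma], where [#|sigma| = m],
    [#|g| = k] and the two are disjoint: ['C(m, i)] of the sets [t] have cardinality [i]. *)
Definition blockp (m k : nat) : R := \prod_(i < m.+1) pc (i + k) ^+ 'C(m, i).

Lemma blockp01 m k : 0 <= blockp m k <= 1.
Proof.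
apply/andP; split.
  by apply: prodr_ge0 => i _; rewrite exprn_ge0 //; case/andP: (pc01 (i + k)).
apply: prodr_ile1 => i _; case/andP: (pc01 (i + k)) => h h'.
by rewrite exprn_ge0 //= exprn_ile1.
Qed.

(** Pascal's rule: subsets of [m.+1] points avoid or contain the last one. This identifies the scale
    [n * blockp j 1 * blockp j 2] of degrees in link graphs with the scale [n * blockp j.+1 1] of
    coface counts. *)
Lemma blockpS m k : blockp m.+1 k = blockp m k * blockp m k.+1.
Proof.
have -> : blockp m k = pc k * \prod_(i < m.+1) pc (i.+1 + k) ^+ 'C(m, i.+1).
  by rewrite /blockp big_ord_recl bin0 big_ord_recr /= bin_small // mulr1.
rewrite /blockp big_ord_recl bin0 -mulrA -big_split; congr (_ * _).
apply: eq_bigr => i _ /=; rewrite /bump /= !add1n.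
by rewrite binS exprD addnS addSn.
Qed.

Variable sigma : {set 'I_n}.

(** For [g] disjoint from [sigma], these are the sets whose part outside [sigma] is [g]; joining [g]
    to [sigma] requires them all in the hypergraph. *)
Definition star_block g : {set {set 'I_n}} :=
  [set t :|: g | t in powerset sigma]%SET.

Lemma star_blockP w g :
  reflect (forall t, t \subset sigma -> (t :|: g)%SET \in w) (star_block g \subset w).
Proof.
apply: (iffP subsetP) => [h t ts|h _ /imsetP[t + ->]].
  by apply: h; apply: imset_f; rewrite powersetE.
by rewrite powersetE; exact: h.
Qed.

(** The part outside [sigma] recovers [g], so different [g] have disjoint, hence independent,
    blocks. *)
Lemma star_block_diff t g : [disjoint g & sigma] -> t \in star_block g ->
  (t :\: sigma)%SET = g.
Proof.
move=> dg /imsetP[u]; rewrite powersetE => us ->.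
rewrite setDUl; move: us; rewrite -setD_eq0 => /eqP ->; rewrite set0U.
by apply/setDidPl.
Qed.

Lemma disjoint_star_block g h : [disjoint g & sigma] -> [disjoint h & sigma] ->
  g != h -> [disjoint star_block g & star_block h].
Proof.
move=> dg dh; apply: contraNT; rewrite -setI_eq0 => /set0Pn[t].
by rewrite inE => /andP[/(star_block_diff dg) <- /(star_block_diff dh) <-].
Qed.

Lemma prod_star_block g : [disjoint g & sigma] ->
  \prod_(t in star_block g) pc #|t| = blockp #|sigma| #|g|.
Proof.
move=> dg; rewrite big_imset /=; last first.
  move=> t u; rewrite !powersetE => ts us /(congr1 (fun a => a :\: g)%SET).
  have d (a : {set 'I_n}) : a \subset sigma -> ((a :|: g) :\: g)%SET = a.
    move=> asig; rewrite setDUl setDv setU0; apply/setDidPl.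
    by rewrite disjoint_sym; apply: disjointWr dg.
  by rewrite !d.
rewrite (partition_big (fun t => inord #|t| : 'I_#|sigma|.+1) xpredT) //=.
apply: eq_bigr => i _; rewrite -cards_draws -prodr_const; apply: eq_big => t.
  rewrite !inE; case: (boolP (t \subset sigma)) => //= ts.
  have tl : (#|t| < #|sigma|.+1)%N by rewrite ltnS subset_leq_card.
  by rewrite -val_eqE /= inordK.
rewrite powersetE => /andP[ts /eqP <-].
have tl : (#|t| < #|sigma|.+1)%N by rewrite ltnS subset_leq_card.
rewrite inordK // cardsU; have -> : (t :&: g)%SET = set0.
  by apply/eqP; rewrite setI_eq0 disjoint_sym; apply: disjointWr dg.
by rewrite cards0 subn0.
Qed.

Definition okstep u v := [&& u != v, u \notin sigma & v \notin sigma].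

(** The matrix [M_sigma]; [q] is subtracted only between distinct vertices of the link. The
    definition does not ask [sigma] to be a simplex, so expectations involve no conditioning. *)
Definition linkmx w (q : R) : 'M[R]_n :=
  \matrix_(u, v) ((okstep u v)%:R *
    ((star_block [set u]%SET \subset w)%:R * (star_block [set v]%SET \subset w)%:R *
     ((star_block [set u; v]%SET \subset w)%:R - q))).

Lemma linkmx_sym w q : (linkmx w q)^T = linkmx w q.
Proof.
apply/matrixP => u v; rewrite !mxE /okstep eq_sym setUC.
by rewrite [(v \notin _) && _]andbC [X in _ * (X * _)]mulrC.
Qed.

(** Indicators are idempotent, so the two copies attached to an inner vertex merge. The walk has at
    least one step, as an empty one would carry no indicator of its starting vertex. *)
Lemma pathprod_linkmx w q x y s :
  pathprod (linkmx w q) x (y :: s) = (path okstep x (y :: s))%:R *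
    (\prod_(v <- [:: x, y & s]) (star_block [set v]%SET \subset w)%:R *
     \prod_(e <- walk_edges x (y :: s)) ((star_block e \subset w)%:R - q)).
Proof.
elim: s x y => [|z s IH] x y.
  by rewrite /= mxE !big_cons !big_nil !mulr1 andbT.
have -> : pathprod (linkmx w q) x [:: y, z & s] =
  linkmx w q x y * pathprod (linkmx w q) y (z :: s) by [].
rewrite IH mxE [path okstep x _]/= -/(path okstep y (z :: s)) [walk_edges x _]/=.
rewrite !big_cons -[in RHS]mulnb natrM.
case: (star_block [set y] \subset w); last by rewrite !(mul0r, mulr0).
by rewrite !mul1r !mulr1; ring.
Qed.

Lemma path_okstep_vertex x y s :
  path okstep x (y :: s) -> {in [:: x, y & s], forall v, v \notin sigma}.
Proof.
elim: s x y => [|z s IH] x y /=.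
  by case/andP=> /and3P[_ xs ys] _ v; rewrite !inE => /orP[] /eqP ->.
case/andP=> /and3P[_ xs _] ps v; rewrite inE => /orP[/eqP -> //|].
exact: IH ps v.
Qed.

Lemma path_okstep_edge x s : path okstep x s ->
  {in walk_edges x s, forall e, #|e| = 2 /\ [disjoint e & sigma]}.
Proof.
elim: s x => //= y s IH x /andP[/and3P[xy xs ys] ps] e.
rewrite inE => /orP[/eqP ->|]; last exact: IH.
by rewrite cards2 xy -setI_eq0 setIUl setU_eq0 !setI_eq0 !disjoints1 xs ys.
Qed.

(** The [m]-th central moment of a Bernoulli variable of parameter [q]. *)
Definition edge_moment (q : R) m : R := (- q) ^+ m + ((1 - q) ^+ m - (- q) ^+ m) * q.

(** Distinct vertices and edges have disjoint blocks, so the expectation factors: repeated vertices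
    collapse, and an edge used [m] times gives its [m]-th central moment. *)
Lemma expect_walk q x y s : q = blockp #|sigma| 2 ->
  path okstep x (y :: s) ->
  expect (fun t => pc #|t|) (fun w =>
    \prod_(v <- [:: x, y & s]) (star_block [set v]%SET \subset w)%:R *
    \prod_(e <- walk_edges x (y :: s)) ((star_block e \subset w)%:R - q)) =
  blockp #|sigma| 1 ^+ size (undup [:: x, y & s]) *
  \prod_(e <- undup (walk_edges x (y :: s)))
     edge_moment q (count_mem e (walk_edges x (y :: s))).
Proof.
move=> qE; set V := [:: x, y & s]; set E := walk_edges _ _ => ok.
have Vs : {in V, forall v, v \notin sigma} := path_okstep_vertex ok.
have Es : {in E, forall e, #|e| = 2 /\ [disjoint e & sigma]} := path_okstep_edge ok.
clearbody V E.
(* Cardinality tells vertices from edges. For an indicator [X], a positive power of [X] is [X]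
   itself, and [(X - q) ^+ m] is affine in [X] with these coefficients. *)
pose a g : R := if #|g| == 1%N then 0 else (- q) ^+ count_mem g E.
pose b g : R := if #|g| == 1%N then 1 else (1 - q) ^+ count_mem g E - (- q) ^+ count_mem g E.
pose gs := [seq [set v]%SET | v <- undup V] ++ undup E.
have inV g : g \in [seq [set v]%SET | v <- undup V] -> #|g| = 1%N.
  by case/mapP => v _ ->; rewrite cards1.
have ugs : uniq gs.
  rewrite cat_uniq map_inj_uniq ?undup_uniq; last exact: set1_inj.
  rewrite andbT; apply/hasPn => e /=; rewrite mem_undup => /Es[e2 _].
  by apply/negP => /inV; rewrite e2.
have dgs : {in gs, forall g, [disjoint g & sigma]}.
  move=> g; rewrite mem_cat => /orP[/mapP[v]|]; rewrite mem_undup.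
    by move=> /Vs vs ->; rewrite disjoints1.
  by case/Es.
rewrite (@eq_expect _ _ _ _ (fun w => \prod_(g <- gs) (a g + b g * (star_block g \subset w)%:R))).
  rewrite expect_blocks //; last first.
    by move=> g h /dgs dg /dgs dh; apply: disjoint_star_block.
  rewrite big_cat big_map /=; congr (_ * _).
    rewrite -[size _]count_predT -iter_mulr_1 -big_const_seq.
    rewrite big_seq [RHS]big_seq; apply: eq_bigr => v; rewrite mem_undup => /Vs vs.
    by rewrite prod_star_block ?disjoints1 // /a /b cards1 eqxx add0r mul1r.
  rewrite big_seq [RHS]big_seq; apply: eq_bigr => e; rewrite mem_undup => eE.
  have [e2 de] := Es e eE.
  by rewrite prod_star_block // /a /b e2 /edge_moment qE.
move=> w; rewrite big_cat big_map /=; congr (_ * _).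
  rewrite -prodr_undup_exp_count big_seq [RHS]big_seq.
  apply: eq_bigr => v; rewrite mem_undup -has_pred1 has_count /a /b cards1 eqxx add0r mul1r.
  by case: (_ \subset _); rewrite ?expr1n // expr0n; case: count.
rewrite -prodr_undup_exp_count big_seq [RHS]big_seq.
apply: eq_bigr => e; rewrite mem_undup => /Es[e2 _]; rewrite /a /b e2 /=.
by case: (_ \subset _); rewrite ?mulr1 ?mulr0 ?addr0 ?sub0r // subrKC.
Qed.

(** A centred variable has mean zero; this kills the walks that use some edge only once. *)
Lemma edge_moment1 q : edge_moment q 1 = 0.
Proof. by rewrite /edge_moment !expr1; ring. Qed.

(** Factoring out [q * (1 - q)] leaves a difference of absolute value at most [(1 - q) + q = 1]. *)
Lemma edge_moment_le q m : 0 <= q <= 1 -> (2 <= m)%N -> `|edge_moment q m| <= q.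
Proof.
move=> /andP[q0 q1]; case: m => [|[|m]] // _.
have -> : edge_moment q m.+2 =
   q * (1 - q) * ((1 - q) ^+ m * (1 - q) - (- q) ^+ m * (- q)).
  by rewrite /edge_moment !exprSr; ring.
have p0 : 0 <= 1 - q by rewrite subr_ge0.
rewrite normrM ger0_norm ?mulr_ge0 // -mulrA -[leRHS]mulr1 ler_wpM2l //.
apply: (@le_trans _ _ (1 * 1)); last by rewrite mulr1.
rewrite ler_pM // ?gerBl //; apply: le_trans (ler_normB _ _) _.
rewrite !normrM !normrX normrN (ger0_norm p0) (ger0_norm q0).
apply: (@le_trans _ _ (1 * (1 - q) + 1 * q)); last by rewrite !mul1r subrK.
by apply: lerD; rewrite ler_wpM2r // exprn_ile1 ?gerBl.
Qed.

(** With [v] distinct vertices and [e] distinct edges a walk contributes at most [X ^+ v * q ^+ e],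
    where [X = blockp #|sigma| 1]. Since [v <= e + 1] and [e <= K], multiplying by [N ^+ v] gives at
    most [N * X * D ^+ e <= N * D ^+ K]. *)
Lemma expect_pathprod_le q x y s K : q = blockp #|sigma| 2 ->
  let N : R := n%:R in let D := N * blockp #|sigma| 1 * q in
  1 <= N * blockp #|sigma| 1 -> 1 <= D -> size (y :: s) = K.*2 ->
  expect (fun t => pc #|t|) (fun w => pathprod (linkmx w q) x (y :: s)) <=
  N * D ^+ K * N^-1 ^+ #|[set v in [:: x, y & s]]%SET|.
Proof.
move=> qE N D NX D1 sK; set X := blockp _ 1 in D NX D1 *.
have X01 : 0 <= X <= 1 by exact: blockp01.
have q01 : 0 <= q <= 1 by rewrite qE; exact: blockp01.
have [X0 X1] := andP X01; have [q0 q1] := andP q01.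
have N0 : 0 <= N by rewrite ler0n.
have D0 : 0 <= D := le_trans ler01 D1.
have rhs0 : 0 <= N * D ^+ K * N^-1 ^+ #|[set v in [:: x, y & s]]%SET|.
  by rewrite !mulr_ge0 ?exprn_ge0 ?invr_ge0.
rewrite (@eq_expect _ _ _ _ (fun w => (path okstep x (y :: s))%:R *
    (\prod_(v <- [:: x, y & s]) (star_block [set v]%SET \subset w)%:R *
     \prod_(e <- walk_edges x (y :: s)) ((star_block e \subset w)%:R - q)))); last first.
  by move=> w; exact: pathprod_linkmx.
rewrite expectZ; case: (boolP (path _ _ _)) => [ok|_]; last by rewrite mul0r.
rewrite mul1r expect_walk // -/X; set V := [:: x, y & s]; set E := walk_edges _ _.
have sE : size E = K.*2 by rewrite size_walk_edges.
have cVE : (size (undup V) <= (size (undup E)).+1)%N := card_walk _ _.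
clearbody V E.
have [all2|/allPn[e]] := boolP (all (fun e => 2 <= count_mem e E)%N (undup E)); last first.
  rewrite mem_undup => eE; rewrite -ltnNge ltnS => c1.
  have c : count_mem e E = 1%N.
    by apply/eqP; rewrite eqn_leq c1 -has_count has_pred1.
  rewrite (bigD1_seq e) ?mem_undup ?undup_uniq //= c edge_moment1.
  by rewrite mul0r mulr0 !mulr_ge0 ?exprn_ge0 ?invr_ge0.
(* Each distinct edge takes up at least two of the [K.*2] steps. *)
have EK : (size (undup E) <= K)%N.
  rewrite -leq_double -sE -(perm_size (perm_count_undup E)) size_flatten /shape.
  rewrite -map_comp sumnE big_map -muln2 -sum1_size big_distrl /= big_seq [leqRHS]big_seq.
  by apply: leq_sum => e eE; rewrite size_nseq mul1n; apply: (allP all2).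
have -> : #|[set v in V]%SET| = size (undup V).
  rewrite cardsE -(card_uniqP (undup_uniq V)); apply: eq_card => v.
  by rewrite mem_undup.
apply: (@le_trans _ _ (X ^+ size (undup V) * q ^+ size (undup E))).
  rewrite ler_wpM2l ?exprn_ge0 //; apply: le_trans (ler_norm _) _.
  rewrite normr_prod -[size _]count_predT -iter_mulr_1 -big_const_seq.
  rewrite big_seq [leRHS]big_seq; apply: ler_prod => e eE; rewrite normr_ge0 /=.
  by apply: edge_moment_le => //; apply: (allP all2).
have Np : 0 < N by rewrite lt_neqAle N0 andbT; apply: contraTneq NX => <-; rewrite mul0r ler10.
have -> : X ^+ size (undup V) = (N * X) ^+ size (undup V) * N^-1 ^+ size (undup V).
  by rewrite exprMn mulrAC -exprMn mulfV ?gt_eqF // expr1n mul1r.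
rewrite mulrAC ler_wpM2r ?exprn_ge0 ?invr_ge0 //.
apply: (@le_trans _ _ ((N * X) ^+ (size (undup E)).+1 * q ^+ size (undup E))).
  by rewrite ler_wpM2r ?exprn_ge0 // ler_weXn2l.
rewrite exprS -mulrA -exprMn -/D ler_pM ?exprn_ge0 ?mulr_ge0 //.
  by rewrite -[leRHS]mulr1 ler_wpM2l.
by rewrite ler_weXn2l.
Qed.

(** The start and the [K.*2] steps form a word of [K.*2.+1] letters, and [wsum_card_aux] sums the
    weights [N^-1] per distinct letter. *)
Lemma expect_trace_le q K : q = blockp #|sigma| 2 -> (0 < K)%N ->
  let N : R := n%:R in let D := N * blockp #|sigma| 1 * q in
  1 <= N * blockp #|sigma| 1 -> 1 <= D ->
  expect (fun t => pc #|t|) (fun w => \tr (linkmx w q ^+ K.*2)) <=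
  N * D ^+ K * (K.*2.+1 ^ K.*2.+1)%:R.
Proof.
move=> qE K0 N D NX D1.
have ND0 : 0 <= N * D ^+ K by rewrite mulr_ge0 ?ler0n // exprn_ge0 // (le_trans ler01).
rewrite (@eq_expect _ _ _ _ (fun w => \sum_x wsum K.*2 (fun s =>
  (last x s == x)%:R * pathprod (linkmx w q) x s))); last first.
  by move=> w; apply: eq_bigr => x _; rewrite exprmxE.
rewrite expect_sum.
apply: (@le_trans _ _ (N * D ^+ K *
  wsum (K.*2).+1 (fun s => #|'I_n|%:R^-1 ^+ #|set0 :|: [set v in s]%SET|))).
  rewrite -wsumZ; apply: ler_sum => x _; rewrite expect_wsum; apply: le_wsum => s sK.
  rewrite expectZ set0U card_ord; case: s sK => [|y s] sK.
    by case: K K0 sK {ND0}.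
  case: (_ == _); last by rewrite mul0r mulr_ge0 // exprn_ge0 // invr_ge0 ler0n.
  by rewrite mul1r; apply: expect_pathprod_le.
rewrite ler_wpM2l //; apply: le_trans (wsum_card_aux _ _ _) _.
by rewrite cards0 mulr1.
Qed.

(** An even power of a symmetric matrix has a squared Frobenius norm as its trace; nonnegativity is
    needed for Markov's inequality. *)
Lemma mxtrace_linkmx_ge0 w q K : 0 <= \tr (linkmx w q ^+ K.*2).
Proof.
have -> : linkmx w q ^+ K.*2 = linkmx w q ^+ K *m linkmx w q ^+ K.
  by rewrite -addnn exprD.
rewrite mxtrace_sqr ?trmxX ?linkmx_sym //.
by apply: sumr_ge0 => i _; apply: sumr_ge0 => j _; rewrite sqr_ge0.
Qed.

(** For a simplex [sigma] with at most [r] vertices this counts its cofaces in the complex, but it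
    makes sense for every [sigma]. *)
Definition degree w : nat :=
  #|[set v | (v \notin sigma) && (star_block [set v]%SET \subset w)]%SET|.

(** The generating function of a binomial variable at [1 / 2], as [2^-1 ^+ X = 1 - X / 2] for an
    indicator [X]. It serves Chernoff's bound for the lower tail. *)
Lemma expect_half_degree :
  expect (fun t => pc #|t|) (fun w => 2^-1 ^+ degree w) =
  (1 - blockp #|sigma| 1 / 2) ^+ (n - #|sigma|).
Proof.
pose gs := [seq [set v]%SET | v <- enum (~: sigma)%SET].
have dgs : {in gs, forall g, [disjoint g & sigma]}.
  by move=> g /mapP[v]; rewrite mem_enum inE => vs ->; rewrite disjoints1.
rewrite (@eq_expect _ _ _ _ (fun w => \prod_(g <- gs)
    (1 + (- 2^-1) * (star_block g \subset w)%:R))).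
  rewrite expect_blocks; last 2 first.
  - by rewrite map_inj_uniq ?enum_uniq //; exact: set1_inj.
  - by move=> g h /dgs dg /dgs dh; exact: disjoint_star_block.
  have <- : #|(~: sigma)%SET| = (n - #|sigma|)%N by rewrite cardsCs setCK card_ord.
  rewrite big_map big_enum_cond /= -prodr_const; apply: eq_big => v; first by rewrite andbT.
  rewrite andbT inE => vs.
  by rewrite prod_star_block ?disjoints1 // cards1 mulNr mulrC.
move=> w; rewrite big_map big_enum_cond /= /degree -prodr_const.
rewrite [RHS](bigID (fun v => star_block [set v]%SET \subset w)) /=.
rewrite [X in _ = _ * X]big1 ?mulr1; last first.
  by move=> v /andP[_ /negPf ->]; rewrite mulr0 addr0.
apply: eq_big => v; first by rewrite !inE andbT.
rewrite inE => /andP[_ ->]; rewrite mulr1 -[X in X - _](@divff _ 2) ?pnatr_eq0 //.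
by rewrite mulrDl mul1r addrK.
Qed.

End LinkMatrix.

(** * Garland's method *)

From mathcomp Require Import ring lra.

Section Garland.
Variables (F : realFieldType) (n : nat).
Implicit Types (s t sigma : {set 'I_n}) (u v : 'I_n).

Definition sgn v s : F := (-1) ^+ #|[set u in s | (u < v)%N]%SET|.

Lemma sgn_sqr v s : sgn v s * sgn v s = 1.
Proof. by rewrite -expr2 sqrr_sign. Qed.

Lemma sgnU1 u v s : u != v -> u \notin s ->
  sgn v (u |: s)%SET = (-1) ^+ (u < v)%N * sgn v s.
Proof.
move=> uv us; rewrite /sgn -exprD; congr (_ ^+ _).
have [lt|ge] := ltnP u v.
  have -> : [set w in u |: s | (w < v)%N]%SET = (u |: [set w in s | (w < v)%N])%SET.
    by apply/setP => w; rewrite !inE; case: eqP => [->|].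
  by rewrite cardsU1 inE (negPf us).
rewrite add0n; congr #|pred_of_set _|; apply/setP => w; rewrite !inE.
by case: eqP => [->|] //=; rewrite ltnNge ge andbF.
Qed.

Lemma sgn_setU1 v s : sgn v (v |: s)%SET = sgn v s.
Proof.
rewrite /sgn; congr (_ ^+ _); congr #|pred_of_set _|; apply/setP => w; rewrite !inE.
by case: eqP => [->|] //=; rewrite ltnn andbF.
Qed.

(** Exactly one of [u < v] and [v < u] holds, so adding the two vertices in the other order changes
    the sign. *)
Lemma sgn_swap u v s : u != v -> u \notin s -> v \notin s ->
  sgn u s * sgn v (u |: s)%SET = - (sgn v s * sgn u (v |: s)%SET).
Proof.
move=> uv us vs; rewrite sgnU1 // sgnU1 // 1?eq_sym //.
case: (ltngtP u v) (uv) => [||/val_inj ->]; rewrite ?eqxx // => _ _;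
  by rewrite ?expr0 ?expr1; ring.
Qed.

(** Double counting of the pairs formed by a set and one of its facets, through [s = t :\ v]. *)
Lemma big_setD1_setU1 (G : {set 'I_n} -> 'I_n -> F) :
  \sum_(t : {set 'I_n}) \sum_(v in t) G (t :\ v)%SET v =
  \sum_(s : {set 'I_n}) \sum_(v | v \notin s) G s v.
Proof.
rewrite (exchange_big_dep xpredT) //= [RHS](exchange_big_dep xpredT) //=.
apply: eq_bigr => v _.
rewrite [RHS](reindex_onto (fun t : {set 'I_n} => (t :\ v)%SET) (fun s => (v |: s)%SET)) /=.
  apply: eq_bigl => t; rewrite !inE eqxx /=.
  by apply/idP/eqP => [/setD1K //|<-]; rewrite setU11.
by move=> s vs; rewrite setU1K.
Qed.

Variables (Y : {set {set 'I_n}}) (j : nat).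
Hypothesis Ysub : forall s t, s \in Y -> t \subset s -> (0 < #|t|)%N -> t \in Y.
Hypothesis j0 : (0 < j)%N.

Variables (x : {set 'I_n} -> F).
Hypothesis x0 : forall s, x s != 0 -> (s \in Y) && (#|s| == j.+1).
Hypothesis cycle : forall sigma, sigma \in Y -> #|sigma| = j ->
  \sum_(v | v \notin sigma) sgn v sigma * x (v |: sigma)%SET = 0.
Hypothesis cocycle : forall t, t \in Y -> #|t| = j.+2 ->
  \sum_(v in t) sgn v t * x (t :\ v)%SET = 0.

(** The function [c_sigma]; with these signs its sum is the coefficient at [sigma] of the boundary
    of [x]. *)
Definition localize sigma v : F :=
  if v \in sigma then 0 else sgn v sigma * x (v |: sigma)%SET.

(** By the sign swap, a cross term of the squared cocycle equation at [t] is minus a product of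
    values localized at a common face. *)
Lemma localize_setD2 t u v : u != v -> u \in t -> v \in t ->
  localize (t :\ u :\ v)%SET u * localize (t :\ u :\ v)%SET v =
  - (sgn u t * x (t :\ u)%SET * (sgn v t * x (t :\ v)%SET)).
Proof.
move=> uv ut vt; set s := (t :\ u :\ v)%SET.
have us : u \notin s by rewrite !inE eqxx andbF.
have vs : v \notin s by rewrite !inE eqxx.
have vus : (v |: s)%SET = (t :\ u)%SET by rewrite setD1K // !inE eq_sym uv.
have uvs : (u |: s)%SET = (t :\ v)%SET.
  by apply/setP => w; rewrite !inE; case: (eqVneq w u) => [->|]; rewrite ?uv ?ut //= andbC.
have us2 : u \notin s by rewrite !inE eqxx andbF.
rewrite /localize (negPf us) (negPf vs) uvs vus.
have -> : sgn u t = sgn u (v |: s)%SET.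
  by rewrite vus -[in LHS](setD1K ut) sgn_setU1.
have -> : sgn v t = sgn v (u |: s)%SET.
  by rewrite uvs -[in LHS](setD1K vt) sgn_setU1.
have e := sgn_swap uv us vs.
rewrite (_ : sgn u s = - (sgn v s * sgn u (v |: s)%SET) * sgn v (u |: s)%SET); last first.
  by rewrite -e -mulrA sgn_sqr mulr1.
transitivity (- (sgn v s * sgn v s) * (sgn u (v |: s)%SET * sgn v (u |: s)%SET *
     (x (t :\ v)%SET * x (t :\ u)%SET))); first by ring.
by rewrite sgn_sqr; ring.
Qed.

(** Each simplex with [j.+1] vertices is seen from its [j.+1] facets. *)
Lemma sum_localize_sqr :
  \sum_(sigma in Y | #|sigma| == j) \sum_v localize sigma v ^+ 2 =
  j.+1%:R * \sum_s x s ^+ 2.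
Proof.
transitivity (\sum_(s : {set 'I_n}) \sum_(v | v \notin s) (x (v |: s)%SET) ^+ 2 *+ (#|s| == j)).
  rewrite big_mkcond; apply: eq_bigr => s _.
  case: ifPn => [/andP[_ ->]|sY].
    rewrite [RHS]big_mkcond; apply: eq_bigr => v _; rewrite /localize.
    by case: ifP; rewrite ?expr0n //= exprMn expr2 sgn_sqr mul1r mulr1n.
  rewrite big1 // => v vs; case: eqP => // sj; rewrite mulr1n.
  apply/eqP; rewrite sqrf_eq0; apply: contraNT sY => /x0 /andP[vsY _].
  by rewrite sj eqxx andbT (Ysub vsY) ?subsetUr // sj.
rewrite -(big_setD1_setU1 (fun s v => x (v |: s)%SET ^+ 2 *+ (#|s| == j))).
rewrite mulr_sumr; apply: eq_bigr => t _.
transitivity (\sum_(v in t) x t ^+ 2 *+ (#|t| == j.+1)).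
  apply: eq_bigr => v vt; rewrite setD1K //; congr (_ *+ _).
  by rewrite (cardsD1 v t) vt.
rewrite sumr_const; have [/x0/andP[_ tj]|] := boolP (x t != 0).
  by rewrite tj mulr1n (eqP tj) mulr_natl.
by rewrite negbK => /eqP ->; rewrite expr0n mul0rn !mulr0 mul0rn.
Qed.

Definition codegree s : nat := #|[set v | (v \notin s) && (v |: s \in Y)%SET]%SET|.

Lemma cocycle_sqr t : t \in Y -> #|t| = j.+2 ->
  \sum_(u in t) x (t :\ u)%SET ^+ 2 =
  \sum_(u in t) \sum_(v in (t :\ u)%SET)
     localize (t :\ u :\ v)%SET u * localize (t :\ u :\ v)%SET v.
Proof.
move=> tY tj; have := cocycle tY tj.
set y := fun v => sgn v t * x (t :\ v)%SET => y0.
have : (\sum_(v in t) y v) * (\sum_(v in t) y v) = 0 by rewrite y0 mulr0.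
rewrite mulr_suml => sq0.
apply/eqP; rewrite -subr_eq0 -sumrB; apply/eqP; rewrite -[RHS]sq0.
apply: eq_bigr => u ut; rewrite mulr_sumr [RHS](bigD1 u) //= /y.
have -> : sgn u t * x (t :\ u)%SET * (sgn u t * x (t :\ u)%SET) = x (t :\ u)%SET ^+ 2.
  by rewrite mulrACA sgn_sqr mul1r.
congr (_ + _); rewrite -sumrN; apply: eq_big => v.
  by rewrite !inE andbC.
rewrite !inE => /andP[vu vt].
by rewrite localize_setD2 ?opprK // eq_sym.
Qed.

(* Squaring the cocycle equations and summing over all simplexes of dimension [j.+1]. *)
Lemma sum_codegree_sqr :
  \sum_s (codegree s)%:R * x s ^+ 2 =
  \sum_(sigma in Y | #|sigma| == j)
    \sum_u \sum_(v | [&& v != u, u \notin sigma, v \notin sigma & u |: (v |: sigma) \in Y]%SET)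
      localize sigma u * localize sigma v.
Proof.
(* Moving the condition on [t] into the summand leaves unrestricted sums, to which [big_setD1_setU1]
   applies. *)
pose top (t : {set 'I_n}) : F := ((t \in Y) && (#|t| == j.+2))%:R.
transitivity (\sum_(t : {set 'I_n}) \sum_(u in t) top t * x (t :\ u)%SET ^+ 2).
  transitivity (\sum_(s : {set 'I_n}) \sum_(u | u \notin s) top (u |: s)%SET * x s ^+ 2).
    apply: eq_bigr => s _; have [/x0/andP[sY sj]|] := boolP (x s != 0); last first.
      by rewrite negbK => /eqP ->; rewrite expr0n mulr0 big1 // => u _; rewrite mulr0.
    rewrite /codegree -sum1_card natr_sum mulr_suml big_mkcond [RHS]big_mkcond.
    apply: eq_bigr => u _; rewrite inE; case: ifPn => [/andP[us usY]|].
      by rewrite us /top usY cardsU1 us (eqP sj) eqxx.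
    by rewrite /top; case: (u \notin s) => //= /negPf ->; rewrite mul0r.
  rewrite -(big_setD1_setU1 (fun s u => top (u |: s)%SET * x s ^+ 2)).
  by apply: eq_bigr => t _; apply: eq_bigr => u ut; rewrite setD1K.
transitivity (\sum_(t : {set 'I_n}) \sum_(u in t) \sum_(v in (t :\ u)%SET)
   top t * (localize (t :\ u :\ v)%SET u * localize (t :\ u :\ v)%SET v)).
  apply: eq_bigr => t _; rewrite -mulr_sumr.
  under [RHS]eq_bigr do rewrite -mulr_sumr.
  rewrite -mulr_sumr /top; case: andP => [[tY /eqP tj]|]; last by rewrite !mul0r.
  by rewrite cocycle_sqr.
(* First [u] and then [v] is removed, which replaces the sum over [t] by one over [t :\ u :\ v]. *)
transitivity (\sum_(s : {set 'I_n}) \sum_(v in s) \sum_(u | u \notin s)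
   top (u |: s)%SET * (localize (s :\ v)%SET u * localize (s :\ v)%SET v)).
  transitivity (\sum_(s : {set 'I_n}) \sum_(u | u \notin s) \sum_(v in s)
   top (u |: s)%SET * (localize (s :\ v)%SET u * localize (s :\ v)%SET v)).
    rewrite -(big_setD1_setU1 (fun s u => \sum_(v in s)
      top (u |: s)%SET * (localize (s :\ v)%SET u * localize (s :\ v)%SET v))).
    by apply: eq_bigr => t _; apply: eq_bigr => u ut; rewrite setD1K.
  by apply: eq_bigr => s _; rewrite exchange_big.
transitivity (\sum_(s : {set 'I_n}) \sum_(v | v \notin s) \sum_(u | u \notin (v |: s)%SET)
   top (u |: (v |: s))%SET * (localize s u * localize s v)).
  rewrite -(big_setD1_setU1 (fun s v => \sum_(u | u \notin (v |: s)%SET)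
   top (u |: (v |: s))%SET * (localize s u * localize s v))).
  by apply: eq_bigr => t _; apply: eq_bigr => u ut; rewrite setD1K.
rewrite [RHS]big_mkcond; apply: eq_bigr => s _.
transitivity (\sum_v \sum_(u | [&& v != u, u \notin s & v \notin s])
   top (u |: (v |: s))%SET * (localize s u * localize s v)).
  rewrite big_mkcond; apply: eq_bigr => v _; case: ifPn => vs.
    by apply: eq_bigl => u; rewrite !inE andbT negb_or eq_sym.
  by rewrite big1 // => u; rewrite !andbF.
have topE u v : [&& v != u, u \notin s & v \notin s] ->
   top (u |: (v |: s))%SET = ((u |: (v |: s) \in Y) && (#|s| == j))%SET%:R.
  case/and3P => vu us vs; rewrite /top !cardsU1 !inE negb_or (eq_sym u v) vu us vs.
  by rewrite !add1n !eqSS.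
case: ifPn => [/andP[sY sj]|nY].
  rewrite (exchange_big_dep xpredT) //=; apply: eq_bigr => u _.
  rewrite big_mkcond [RHS]big_mkcond; apply: eq_bigr => v _.
  case: ifPn => [c|]; last by case: (v != u) (u \notin s) (v \notin s) => [] [] [].
  rewrite topE // sj andbT; case/and3P: c => -> -> -> /=.
  by case: ifP; rewrite ?mul1r ?mul0r.
rewrite big1 // => v _; rewrite big1 // => u c; rewrite topE //.
case: andP; rewrite ?mul0r // => -[uY sj]; case/negP: nY; rewrite sj andbT.
by apply: (Ysub uY); rewrite ?(eqP sj) // setUA subsetUr.
Qed.

(** The two bounds enclose the sum of [sum_codegree_sqr] and give [D * \sum_s x s ^+ 2 <= B *
    j.+1%:R * \sum_s x s ^+ 2]. *)
Lemma garland (D B : F) :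
  (forall s, s \in Y -> #|s| = j.+1 -> D <= (codegree s)%:R) ->
  (forall sigma (f : 'I_n -> F), sigma \in Y -> #|sigma| = j ->
     (forall v, f v != 0 -> (v \notin sigma) && (v |: sigma \in Y)%SET) ->
     \sum_v f v = 0 ->
     \sum_u \sum_(v | [&& v != u, u \notin sigma, v \notin sigma &
                           u |: (v |: sigma) \in Y]%SET) f u * f v <=
     B * \sum_v f v ^+ 2) ->
  B * j.+1%:R < D -> forall s, x s = 0.
Proof.
move=> deg gap BD; have le : D * \sum_s x s ^+ 2 <= B * j.+1%:R * \sum_s x s ^+ 2.
  apply: (@le_trans _ _ (\sum_s (codegree s)%:R * x s ^+ 2)).
    rewrite mulr_sumr; apply: ler_sum => s _.
    have [/x0/andP[sY /eqP sj]|] := boolP (x s != 0).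
      by rewrite ler_wpM2r ?sqr_ge0 ?deg.
    by rewrite negbK => /eqP ->; rewrite expr0n !mulr0.
  rewrite sum_codegree_sqr -mulrA -sum_localize_sqr mulr_sumr; apply: ler_sum.
  move=> sigma /andP[sY /eqP sj]; apply: gap => // [v|].
    rewrite /localize; case: ifPn => [_|vs]; first by rewrite eqxx.
    by rewrite mulf_eq0 negb_or => /andP[_ /x0/andP[-> _]].
  rewrite -[RHS](cycle sY sj) [RHS]big_mkcond; apply: eq_bigr => v _.
  by rewrite /localize; case: ifP.
have s0 s : 0 <= x s ^+ 2 by rewrite sqr_ge0.
have N0 : \sum_s x s ^+ 2 = 0.
  apply/eqP; rewrite eq_le sumr_ge0 // andbT leNgt; apply/negP => N0.
  by move: le; rewrite ler_pM2r // leNgt BD.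
move=> s; apply/eqP; rewrite -sqrf_eq0; apply/eqP.
by move/psumr_eq0P: N0; apply.
Qed.

End Garland.

(** * Rational homology *)

Section Homology.
Variables (n : nat) (Y : {set {set 'I_n}}).
Hypothesis Ysub : forall s t : {set 'I_n},
  s \in Y -> t \subset s -> (0 < #|t|)%N -> t \in Y.

Implicit Types (s t : {set 'I_n}) (u v : 'I_n).

(** Extension by zero lets chains be summed over all vertex sets. *)
Definition extend i (c : chain Y i) (s : {set 'I_n}) : rat :=
  if insub s is Some f then c f else 0.

Lemma extend_val i (c : chain Y i) (f : face Y i) : extend c (val f) = c f.
Proof. by rewrite /extend valK. Qed.

Lemma extend_neq0 i (c : chain Y i) s :
  extend c s != 0 -> (s \in Y) && (#|s| == i.+1).
Proof.
by rewrite /extend; case: insubP => [f + _ _|]; rewrite ?inE // eqxx.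
Qed.

Lemma sum_face i (G : {set 'I_n} -> rat) (c : chain Y i) :
  \sum_(s : face Y i) G (val s) * c s = \sum_s G s * extend c s.
Proof.
rewrite [RHS](bigID (fun s => s \in faces Y i)) /= [X in _ = _ + X]big1 ?addr0.
  transitivity (\sum_(s : face Y i) G (val s) * extend c (val s)).
    by apply: eq_bigr => s _; rewrite extend_val.
  by symmetry; apply: (big_sub (faces Y i) (fun s => G s * extend c s)).
move=> s; rewrite inE => sY; have [/extend_neq0|] := boolP (extend c s != 0).
  by rewrite (negPf sY).
by rewrite negbK => /eqP ->; rewrite mulr0.
Qed.

Lemma boundaryE i (c : chain Y i.+1) (t : face Y i) :
  boundary Y i.+1 i c t =
  \sum_(v | v \notin val t) sgn rat v (val t) * extend c (v |: val t)%SET.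
Proof.
rewrite lfunE /= ffunE (sum_face (fun s => incidence s (val t))).
transitivity (\sum_(s : {set 'I_n}) \sum_(v in s)
   (s :\ v == val t)%SET%:R * (sgn rat v (s :\ v)%SET * extend c (v |: (s :\ v))%SET)).
  apply: eq_bigr => s _; rewrite /incidence mulr_suml big_mkcondr.
  apply: eq_bigr => v vs; case: eqP => _; last by rewrite !mul0r.
  by rewrite mul1r setD1K // -[in RHS]sgn_setU1 setD1K.
rewrite (big_setD1_setU1 (fun s v =>
   (s == val t)%SET%:R * (sgn rat v s * extend c (v |: s)%SET))).
rewrite (bigD1 (val t)) //= [X in _ + X]big1 ?addr0.
  by apply: eq_bigr => v _; rewrite eqxx mul1r.
by move=> s /negPf ->; rewrite big1 // => v _; rewrite mul0r.
Qed.

(** At a set outside [Y] both sides vanish, because no coface of it lies in [Y] either. *)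
Lemma extend_boundary i (c : chain Y i.+1) s : #|s| = i.+1 ->
  extend (boundary Y i.+1 i c) s =
  \sum_(v | v \notin s) sgn rat v s * extend c (v |: s)%SET.
Proof.
move=> si; rewrite {1}/extend; case: insubP => [f fY fs|].
  by rewrite boundaryE fs.
rewrite inE si eqxx andbT => sY; rewrite big1 // => v vs.
have [/extend_neq0/andP[vsY _]|] := boolP (extend c (v |: s)%SET != 0).
  by case/negP: sY; apply: Ysub vsY _ _; rewrite ?subsetUr ?si.
by rewrite negbK => /eqP ->; rewrite mulr0.
Qed.

(** Exchanging the two added vertices reverses the sign of every term, so each coefficient equals
    its own negative. *)
Lemma boundary_boundary i (c : chain Y i.+2) :
  boundary Y i.+1 i (boundary Y i.+2 i.+1 c) = 0.
Proof.
apply/ffunP => t; rewrite boundaryE [RHS]ffunE.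
have /andP[_ /eqP ti] : (val t \in Y) && (#|val t| == i.+1) by have := valP t; rewrite inE.
set s := val t in ti *.
pose g v u := sgn rat v s * (sgn rat u (v |: s)%SET * extend c (u |: (v |: s))%SET).
have -> : \sum_(v | v \notin s) sgn rat v s * extend (boundary Y i.+2 i.+1 c) (v |: s)%SET =
  \sum_v \sum_(u | [&& v != u, v \notin s & u \notin s]) g v u.
  rewrite big_mkcond; apply: eq_bigr => v _; case: ifPn => vs; last first.
    by rewrite big1 // => u; rewrite andbF.
  rewrite extend_boundary ?cardsU1 ?vs ?ti // mulr_sumr; apply: eq_bigl => u.
  by rewrite !inE negb_or eq_sym.
set S := \sum_v _; have : S = - S.
  rewrite {1}/S (exchange_big_dep xpredT) //= -sumrN; apply: eq_bigr => u _.
  rewrite -sumrN; apply: eq_big => v.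
    by rewrite eq_sym [(v \notin s) && _]andbC.
  case/and3P => vu vs us; rewrite /g !mulrA sgn_swap // mulNr.
  by rewrite setUCA.
move/eqP; rewrite -subr_eq0 opprK -mulr2n mulrn_eq0 /= => /eqP //.
Qed.

Definition chain_pairing i (b c : chain Y i) : rat := \sum_s b s * c s.

(* A dimension count: the orthogonality conditions are [\dim B] linear equations on cycles. *)
Lemma cycles_le_boundaries j :
  (forall c : chain Y j.+1, c \in cycles Y j.+1 ->
    (forall d, chain_pairing (boundary Y j.+2 j.+1 d) c = 0) -> c = 0) ->
  (cycles Y j.+1 <= boundaries Y j.+1)%VS.
Proof.
move=> harm; set Z := cycles _ _; set B := boundaries _ _.
have BZ : (B <= Z)%VS.
  apply/subvP => _ /memv_imgP[d _ ->]; rewrite memv_ker; apply/eqP.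
  exact: boundary_boundary.
pose X := vbasis B.
pose f (c : chain Y j.+1) : {ffun 'I_(\dim B) -> rat^o} :=
  [ffun i : 'I_(\dim B) => chain_pairing X`_i c].
have f_lin : linear f.
  move=> a c d; apply/ffunP => i; rewrite !ffunE /chain_pairing scaler_sumr -big_split.
  by apply: eq_bigr => s _; rewrite !ffunE mulrDr /GRing.scale /= mulrCA.
pose fL : {linear chain Y j.+1 -> {ffun 'I_(\dim B) -> rat^o}} :=
  HB.pack f (GRing.isLinear.Build _ _ _ _ f f_lin).
(* A cycle killed by [fL] is orthogonal to a basis of the boundaries, hence zero; so [fL] is
   injective on cycles. *)
have /eqP kerf : (Z :&: lker (linfun fL) == 0)%VS.
  rewrite -subv0; apply/subvP => c; rewrite memv_cap memv_ker lfunE memv0 => /andP[cZ /eqP fc].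
  apply/eqP; apply: harm => // d.
  have : boundary Y j.+2 j.+1 d \in <<X>>%VS.
    by rewrite (span_basis (vbasisP B)) memv_img // memvf.
  move=> /coord_span ->; rewrite /chain_pairing.
  under eq_bigr => s _ do rewrite sum_ffunE mulr_suml.
  rewrite exchange_big big1 // => i _ /=.
  transitivity (coord X i (boundary Y j.+2 j.+1 d) * chain_pairing X`_i c).
    rewrite mulr_sumr; apply: eq_bigr => s _.
    by rewrite ffunE mulrA.
  by move/ffunP: fc => /(_ i); rewrite !ffunE => ->; rewrite mulr0.
have := limg_ker_dim (linfun fL) Z; rewrite kerf dimv0 add0n => dimZ.
have : (\dim Z <= \dim B)%N.
  rewrite -dimZ; apply: leq_trans (dimvS (subvf _)) _.
  rewrite dimvf /dim /=.
 by rewrite card_ord -[leqRHS]muln1.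
move=> le; have : (B == Z)%VS by rewrite eqEdim BZ.
by move/eqP => ->.
Qed.

Lemma homology_eq0P j : (cycles Y j <= boundaries Y j)%VS ->
  forall h : homology Y j, h = 0.
Proof.
move=> ZB h; rewrite -[h]reprK -[0]reprK; apply/eqP.
rewrite -Quotient.idealrBE /=.
rewrite -memv_preim lfunE /=; apply: (subvP ZB). by rewrite rpredB ?subvsP.
Qed.

Lemma homology_eq0_garland (F : realFieldType) j (D B : F) :
  (0 < j)%N ->
  (forall s, s \in Y -> #|s| = j.+1 -> D <= (codegree Y s)%:R) ->
  (forall sigma (f : 'I_n -> F), sigma \in Y -> #|sigma| = j ->
     (forall v, f v != 0 -> (v \notin sigma) && (v |: sigma \in Y)%SET) ->
     \sum_v f v = 0 ->
     \sum_u \sum_(v | [&& v != u, u \notin sigma, v \notin sigma &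
                           u |: (v |: sigma) \in Y]%SET) f u * f v <=
     B * \sum_v f v ^+ 2) ->
  B * j.+1%:R < D ->
  forall h : homology Y j, h = 0.
Proof.
case: j => // j _ deg gap BD; apply: homology_eq0P; apply: cycles_le_boundaries.
move=> c cZ orth; pose x s : F := ratr (extend c s).
have ratr_sgn v s : ratr (sgn rat v s) = sgn F v s by rewrite /sgn rmorph_sign.
suff x0 s : x s = 0.
  apply/ffunP => s; rewrite ffunE -extend_val; apply/eqP.
  by rewrite -(fmorph_eq0 (ratr : {rmorphism rat -> F})); apply/eqP; exact: x0.
apply: (garland Ysub _ _ _ _ deg gap BD) => // {s} [s|s sY sj|t tY tj].
- by rewrite fmorph_eq0 => /extend_neq0.
- have : extend (boundary Y j.+1 j c) s = 0.
    move: cZ; rewrite memv_ker => /eqP /= ->.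
    by rewrite /extend; case: insubP => // f _ _; rewrite ffunE.
  rewrite extend_boundary // => /(congr1 (ratr : rat -> F)).
  rewrite rmorph0 rmorph_sum /= => e; rewrite -[RHS]e; apply: eq_bigr => v _.
  by rewrite rmorphM /= ratr_sgn.
- have tf : t \in faces Y j.+2 by rewrite inE tY tj eqxx.
  (* Orthogonality to the boundary of the single simplex [t] is the cocycle equation at [t]. *)
  pose d : chain Y j.+2 := [ffun f => (val f == t)%:R].
  have dE s : extend d s = (s == t)%:R.
    rewrite /extend; case: insubP => [f _ fs|]; first by rewrite ffunE fs.
    by case: eqP => // ->; rewrite tf.
  suff e : \sum_(v in t) sgn rat v t * extend c (t :\ v)%SET = 0.
    move/(congr1 (ratr : rat -> F)): e; rewrite rmorph0 rmorph_sum /= => e.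
    by rewrite -[RHS]e; apply: eq_bigr => v _; rewrite rmorphM /= ratr_sgn.
  rewrite -[RHS](orth d) /chain_pairing.
  transitivity (\sum_(s : {set 'I_n}) (\sum_(v | v \notin s)
     sgn rat v s * (v |: s == t)%SET%:R) * extend c s); last first.
    rewrite -(sum_face (fun s => \sum_(v | v \notin s) sgn rat v s * (v |: s == t)%SET%:R)).
    apply: eq_bigr => s _; rewrite boundaryE; congr (_ * _); apply: eq_bigr => v _.
    by rewrite dE.
  transitivity (\sum_(s : {set 'I_n}) \sum_(v in s)
    sgn rat v (s :\ v)%SET * (v |: (s :\ v) == t)%SET%:R * extend c (s :\ v)%SET).
    rewrite (bigD1 t) //= [X in _ = _ + X]big1 ?addr0.
      apply: eq_bigr => v vt; rewrite setD1K // eqxx mulr1; congr (_ * _).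
      by rewrite -[in LHS](setD1K vt) sgn_setU1.
    move=> s st; rewrite big1 // => v vs.
    by rewrite setD1K // (negPf st) mulr0 mul0r.
  rewrite (big_setD1_setU1 (fun s v =>
    sgn rat v s * (v |: s == t)%SET%:R * extend c s)).
  by apply: eq_bigr => s _; rewrite mulr_suml.
Qed.

End Homology.

(** * The complex of a hypergraph *)

Section RandomHypergraph.
Variables (n r : nat).
Implicit Types (s t g sigma : {set 'I_n}) (w Y : {set {set 'I_n}}) (u v : 'I_n).

Definition complex_of w : {set {set 'I_n}} :=
  [set s | [&& s != set0, (#|s| <= r.+1)%N &
     [forall t : {set 'I_n}, (t != set0) && (t \subset s) ==> (t \in w)]]]%SET.

Lemma complex_ofP w s : reflect
  [/\ s != set0, (#|s| <= r.+1)%N & forall t, t != set0 -> t \subset s -> t \in w]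
  (s \in complex_of w).
Proof.
rewrite inE; apply: (iffP and3P) => [[s0 sr /forallP h]|[s0 sr h]]; split=> //.
  by move=> t t0 ts; apply: (implyP (h t)); rewrite t0.
by apply/forallP => t; apply/implyP => /andP[t0 ts]; exact: h.
Qed.

Lemma complex_of_sub w s t :
  s \in complex_of w -> t \subset s -> (0 < #|t|)%N -> t \in complex_of w.
Proof.
move=> /complex_ofP[s0 sr sw] ts t0; apply/complex_ofP; split.
- by rewrite -card_gt0.
- by apply: leq_trans sr; exact: subset_leq_card.
- by move=> a a0 at_; apply: sw => //; apply: subset_trans ts.
Qed.

(** The nonempty subsets of [sigma :|: g] are sorted by their part outside [sigma]; those without
    such a part are present because [sigma] is a simplex. *)
Lemma complex_ofU w sigma g : sigma \in complex_of w -> (#|sigma :|: g| <= r.+1)%N ->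
  (sigma :|: g \in complex_of w)%SET =
  [forall h : {set 'I_n}, (h != set0) && (h \subset g) ==> (star_block sigma h \subset w)]%SET.
Proof.
move=> /[dup] sY /complex_ofP[s0 sr sw] sg; apply/complex_ofP/forallP => [[_ _ h] a|h].
  apply/implyP => /andP[a0 ag]; apply/star_blockP => t ts; apply: h.
    by rewrite setU_eq0 negb_and a0 orbT.
  by rewrite setUSS.
split=> // [|t t0 tsg]; first by rewrite setU_eq0 negb_and s0.
have [tg0|tg] := eqVneq (t :\: sigma)%SET set0.
  by apply: sw => //; rewrite -setD_eq0 tg0.
have := h (t :\: sigma)%SET; rewrite tg subDset tsg /= => /star_blockP/(_ (t :&: sigma)%SET).
by rewrite subsetIr setID; apply.
Qed.

Lemma complex_ofU1 w sigma v : sigma \in complex_of w -> (#|sigma| <= r)%N ->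
  (v |: sigma \in complex_of w)%SET = (star_block sigma [set v]%SET \subset w).
Proof.
move=> sY sr; rewrite setUC complex_ofU //; last first.
  by rewrite setUC cardsU1; case: (v \notin sigma); rewrite ?ltnS // leqW.
apply/forallP/idP => [/(_ [set v]%SET)|h a].
  by rewrite subxx andbT -card_gt0 cards1.
by apply/implyP; rewrite subset1 => /andP[/negPf ->]; rewrite orbF => /eqP ->.
Qed.

Lemma complex_ofU2 w sigma u v : sigma \in complex_of w -> (#|sigma| < r)%N ->
  (u |: (v |: sigma) \in complex_of w)%SET =
  [&& star_block sigma [set u]%SET \subset w, star_block sigma [set v]%SET \subset w
    & star_block sigma [set u; v]%SET \subset w].
Proof.
move=> sY sr; rewrite setUA setUC complex_ofU //; last first.
  rewrite cardsU; apply: leq_trans (leq_subr _ _) _; rewrite cards2.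
  by apply: (@leq_trans (#|sigma| + 2)); rewrite ?leq_add2l ?addn2 //; case: (_ != _).
apply/forallP/and3P => [h|[hu hv huv] a].
  have h' a : a != set0 -> a \subset [set u; v]%SET -> star_block sigma a \subset w.
    by move=> a0 asub; apply: (implyP (h a)); rewrite a0.
  by split; apply: h'; rewrite -?card_gt0 ?cards1 ?cards2 // ?sub1set ?inE ?eqxx ?orbT.
apply/implyP => /andP[a0 asub].
have [ua|ua] := boolP (u \in a); have [va|va] := boolP (v \in a).
- suff -> : a = [set u; v]%SET by [].
  by apply/eqP; rewrite eqEsubset asub subUset !sub1set ua.
- suff -> : a = [set u]%SET by [].
  apply/eqP; rewrite eqEsubset sub1set ua andbT; apply/subsetP => x xa.
  have := subsetP asub x xa; rewrite !inE => /orP[//|/eqP xv].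
  by move: va; rewrite -xv xa.
- suff -> : a = [set v]%SET by [].
  apply/eqP; rewrite eqEsubset sub1set va andbT; apply/subsetP => x xa.
  have := subsetP asub x xa; rewrite !inE => /orP[/eqP xu|//].
  by move: ua; rewrite -xu xa.
- case/set0Pn: a0 => x xa; have := subsetP asub x xa; rewrite !inE.
  by case/orP => /eqP xE; move: xa; rewrite xE ?(negPf ua) ?(negPf va).
Qed.

Lemma homology_complex_of_eq0 (R : realFieldType) w (j a : nat) (q B D : R) :
  (0 < j)%N -> (j < r)%N -> 0 <= q -> 0 <= B -> B * j.+1%:R < D ->
  (forall s, #|s| = j.+1 -> D <= (degree s w)%:R) ->
  (forall sigma, #|sigma| = j ->
     \tr (linkmx sigma w q ^+ (2 ^ a.+1)) <= B ^+ (2 ^ a.+1)) ->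
  forall h : homology (complex_of w) j, h = 0.
Proof.
move=> j0 jr q0 B0 BD deg tr; apply: (homology_eq0_garland _ j0 _ _ BD).
- exact: complex_of_sub.
- move=> s sY sj; apply: le_trans (deg s sj) _; rewrite ler_nat.
  apply: eq_leq; congr #|pred_of_set _|; apply/setP => v; rewrite [LHS]inE [RHS]inE.
  by rewrite complex_ofU1 ?sj.
move=> sigma f sY sj supp f0.
apply: le_trans (qform_le_trace _ (linkmx_sym _ _ _) B0 (tr _ sj)).
have suppE v : f v != 0 -> (v \notin sigma) && (star_block sigma [set v]%SET \subset w).
  by move=> /supp; rewrite complex_ofU1 // sj ltnW.
rewrite -subr_ge0.
(* The centring contributes [- q * f u * f v] off the diagonal only. Completing the double sum costs
   [q * \sum_u f u ^+ 2], and the completed sum factors and vanishes by [f0]. *)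
have -> : qform (linkmx sigma w q) f -
  \sum_u \sum_(v | [&& v != u, u \notin sigma, v \notin sigma &
       u |: (v |: sigma) \in complex_of w]%SET) f u * f v =
  q * \sum_u f u ^+ 2 - q * ((\sum_u f u) * \sum_v f v).
  rewrite /qform mulr_suml !mulr_sumr -!sumrB; apply: eq_bigr => u _.
  rewrite !mulr_sumr [X in _ - X]big_mkcond -sumrB.
  have -> : q * f u ^+ 2 = \sum_v (v == u)%:R * (q * f u * f v).
    rewrite (bigD1 u) //= eqxx big1 ?addr0; first by rewrite mul1r expr2 mulrA.
    by move=> v /negPf ->; rewrite mul0r.
  rewrite -sumrB; apply: eq_bigr => v _; rewrite mxE complex_ofU2 ?sj // /okstep.
  have [fu|/suppE/andP[us uw]] := eqVneq (f u) 0.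
    by rewrite fu; case: ifP => _; rewrite !(mul0r, mulr0).
  have [fv|/suppE/andP[vs vw]] := eqVneq (f v) 0.
    by rewrite fv; case: ifP => _; rewrite !(mul0r, mulr0).
  rewrite us vs uw vw (eq_sym u v) /=.
  case: (v == u) => /=; first by ring.
  by case: (star_block _ _ \subset _) => /=; ring.
by rewrite f0 mulr0 mulr0 subr0 mulr_ge0 // sumr_ge0 // => u _; rewrite sqr_ge0.
Qed.

End RandomHypergraph.

(** * The random complex as an image of the random hypergraph *)

Section Pushforward.
Variables (R : realType) (n r : nat) (p : 'I_r.+1 -> R).
Implicit Types (s t : {set 'I_n}) (w Y : {set {set 'I_n}}).

(* Indexed by cardinality, hence shifted by one from the dimension. *)
Definition face_prob (k : nat) : R :=
  if (0 < k <= r.+1)%N then p (inord k.-1) else 0.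

Definition all_external Y : {set {set 'I_n}} :=
  [set s : {set 'I_n} | [&& (0 < #|s| <= r.+1)%N, s \notin Y &
     [forall t : {set 'I_n}, (t != set0) && (t \proper s) ==> (t \in Y)]]]%SET.

Lemma complex_of_Omega w : complex_of r w \in Omega n r.
Proof.
rewrite inE; apply/andP; split.
  apply/andP; split.
    by apply/negP => /complex_ofP[]; rewrite eqxx.
  apply/forallP => s; apply/implyP => sY; apply/forallP => t; apply/implyP.
  by case/andP => t0 ts; apply: complex_of_sub sY ts _; rewrite card_gt0.
by apply/forallP => s; apply/implyP => /complex_ofP[].
Qed.

(** The hypergraph must contain [Y] and avoid its external faces. Conversely, a smallest simplex of
    [complex_of r w] outside [Y] would be an external face lying in [w]. *)
Lemma complex_of_eq w Y : Y \in Omega n r ->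
  (complex_of r w == Y) = [forall t, if t \in w then t \notin all_external Y else t \notin Y].
Proof.
rewrite inE => /andP[/andP[Y0 /forallP Ycl] /forallP Yr].
have cl s t : s \in Y -> t != set0 -> t \subset s -> t \in Y.
  move=> sY t0 ts; have /implyP/(_ sY)/forallP/(_ t)/implyP := Ycl s.
  by rewrite t0 ts; apply.
have ne s : s \in Y -> s != set0 by move=> sY; apply: contraNneq Y0 => <-.
apply/eqP/forallP => [wY t|h].
  case: ifPn => tw.
    rewrite inE; apply/negP => /and3P[/andP[t0 tr] tY /forallP text].
    case/negP: tY; rewrite -wY; apply/complex_ofP; split=> //; first by rewrite -card_gt0.
    move=> a a0; rewrite subEproper => /orP[/eqP -> //|at_].
    have : a \in Y by apply: (implyP (text a)); rewrite a0.
    by rewrite -wY => /complex_ofP[_ _]; apply.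
  apply: contra tw; rewrite -wY => /complex_ofP[t0 _]; exact.
have Yw t : t \in Y -> t \in w by have := h t; case: ifP => // _ /negP.
apply/setP => s; apply/idP/idP; last first.
  move=> sY; apply/complex_ofP; split; first exact: ne.
    exact: (implyP (Yr s)).
  by move=> t t0 ts; apply: Yw; apply: cl ts.
have [m] := ubnP #|s|; elim: m s => // m IH s sm /[dup] sw /complex_ofP[s0 sr sub].
have := h s; rewrite (sub s s0 (subxx _)) inE card_gt0 s0 sr /=.
case: (s \in Y) => //=; rewrite -/(is_true _) => /negP; case.
apply/forallP => t; apply/implyP => /andP[t0 ts]; apply: IH.
  by apply: leq_trans (proper_card ts) _.
by apply: complex_of_sub sw (proper_sub ts) _; rewrite card_gt0.
Qed.

Lemma face_prob_ord (i : 'I_r.+1) : face_prob i.+1 = p i.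
Proof. by rewrite /face_prob /= ltn_ord /= inord_val. Qed.

(** By [complex_of_eq] membership is prescribed on [Y] and on its external faces, while all other
    sets are free and contribute a factor [1]. *)
Lemma expect_complex_of_eq Y : Y \in Omega n r ->
  expect (fun t : {set 'I_n} => face_prob #|t|) (fun w => (complex_of r w == Y)%:R) =
  prob p Y.
Proof.
move=> YO.
rewrite (@eq_expect _ _ _ _ (fun w => \prod_t (if t \in w then (t \notin all_external Y)%:R
   else (t \notin Y)%:R))); last first.
  move=> w; rewrite complex_of_eq //; case: forallP => [h|/forallP].
    by rewrite big1 // => t _; have := h t; case: ifP => _ ->.
  rewrite negb_forall => /existsP[t ht]; rewrite (bigD1 t) //=.
  by move: ht; case: ifP => _ /negPf ->; rewrite mul0r.
have Y0 t : t \in Y -> (0 < #|t| <= r.+1)%N.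
  move=> tY; move: YO; rewrite inE => /andP[/andP[Y0 _] /forallP/(_ t)/implyP ->] //.
  by rewrite andbT card_gt0; apply: contraNneq Y0 => <-.
rewrite expect_prod /prob.
transitivity ((\prod_(t in Y) face_prob #|t|) * \prod_(t in all_external Y) (1 - face_prob #|t|)).
  rewrite [X in X * _]big_mkcond [X in _ * X]big_mkcond -big_split; apply: eq_bigr => t _ /=.
  case: (boolP (t \in Y)) => tY.
    by rewrite inE tY andbF /= !mulr1 mulr0 addr0.
  case: (t \in all_external Y); rewrite ?mulr0 ?mulr1 ?mul1r ?add0r //.
  by rewrite subrKC.
have dimP t : (0 < #|t| <= r.+1)%N -> forall i : 'I_r.+1,
    (inord #|t|.-1 == i) = (#|t| == i.+1).
  move=> /andP[t0 tr] i; rewrite -val_eqE /= inordK ?prednK //.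
  by rewrite -[in RHS](prednK t0) eqSS.
congr (_ * _).
  rewrite (partition_big (fun t => inord #|t|.-1 : 'I_r.+1) xpredT) //=.
  apply: eq_bigr => i _; rewrite -prodr_const; apply: eq_big => t.
    by rewrite inE; case: (boolP (t \in Y)) => //= /Y0 /dimP ->.
  by case/andP => /Y0 tb; rewrite dimP // => /eqP ->; rewrite face_prob_ord.
rewrite (partition_big (fun t => inord #|t|.-1 : 'I_r.+1) xpredT) //=.
apply: eq_bigr => i _; rewrite -prodr_const; apply: eq_big => t.
  rewrite !inE; case: (boolP (0 < #|t| <= r.+1)%N) => [tb|tb] /=.
    by rewrite dimP // andbC.
  by apply/esym/negbTE; apply: contra tb => /andP[/eqP -> _]; rewrite ltn_ord.
rewrite inE => /andP[/and3P[tb _ _]]; rewrite dimP // => /eqP ->.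
by rewrite face_prob_ord.
Qed.

Lemma PrE (A : {set {set 'I_n}} -> Prop) :
  Pr p A = expect (fun t : {set 'I_n} => face_prob #|t|)
                  (fun w => (`[< A (complex_of r w) >])%:R).
Proof.
rewrite /expect (partition_big (complex_of r) (mem (Omega n r))) /=; last first.
  by move=> w _; exact: complex_of_Omega.
rewrite /Pr big_mkcondr; apply: eq_bigr => Y YO.
case: ifP => AY; last by rewrite big1 // => w /eqP ->; rewrite AY mulr0.
rewrite -expect_complex_of_eq // /expect [RHS]big_mkcond; apply: eq_bigr => w _.
by case: eqP => [->|_]; rewrite ?AY // mulr0.
Qed.

End Pushforward.

From mathcomp Require Import all_classical all_reals all_analysis.

Import numFieldNormedType.Exports.

Local Open Scope classical_set_scope.
Local Open Scope ring_scope.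

(** * Tail bounds *)

Lemma bin_leq_exp n m : ('C(n, m) <= n ^ m)%N.
Proof.
apply: (@leq_trans (n ^_ m)); first by rewrite -bin_ffact leq_pmulr ?fact_gt0.
by elim: m => // m IH; rewrite ffactnSr expnSr leq_mul ?leq_subr.
Qed.

(** One term of the exponential series suffices. Chernoff's bound is thereby weakened to the same
    power of [D] as the trace bound. *)
Lemma expRN_le (R : realType) (y : R) (m : nat) : (0 < m)%N -> 0 < y ->
  expR (- y) <= (m`!)%:R / y ^+ m.
Proof.
case: m => // m _ y0; rewrite expRN -[leRHS]invf_div lef_pV2 ?posrE ?expR_gt0 //.
  by apply: le_trans (expR_ge1Dxn m (ltW y0)); rewrite lerDr.
by rewrite divr_gt0 ?exprn_gt0 // ltr0n fact_gt0.
Qed.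

Lemma sum_card_le (R : realType) (n m : nat) (G : {set 'I_n} -> R) (b : R) : 0 <= b ->
  (forall s : {set 'I_n}, #|s| = m -> G s <= b) ->
  \sum_(s : {set 'I_n} | #|s| == m) G s <= n%:R ^+ m * b.
Proof.
move=> b0 Gb; apply: (@le_trans _ _ (\sum_(s : {set 'I_n} | #|s| == m) b)).
  by apply: ler_sum => s /eqP; exact: Gb.
have -> : \sum_(s : {set 'I_n} | #|s| == m) b = ('C(n, m))%:R * b.
  rewrite -[in 'C(n, m)](card_ord n) -card_draws mulr_natl -sumr_const.
  by apply: eq_bigl => s; rewrite inE.
by rewrite ler_wpM2r // -natrX ler_nat bin_leq_exp.
Qed.

Section TailBound.
Variables (R : realType) (n r j K : nat) (p : 'I_r.+1 -> R).
Hypothesis p01 : forall i, 0 <= p i <= 1.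
Hypotheses (j0 : (0 < j)%N) (jr : (j < r)%N) (jn : (j.+1.*2 <= n)%N).

Let N : R := n%:R.
Let pc := face_prob p.
Let q := blockp pc j 2.
Let Q := blockp pc j.+1 1.
Let D := N * Q.

Let pc01 i : 0 <= pc i <= 1.
Proof. by rewrite /pc /face_prob; case: ifP => _; rewrite ?lexx ?ler01. Qed.

Let pt01 (t : {set 'I_n}) : 0 <= pc #|t| <= 1. Proof. exact: pc01. Qed.

Let DE : D = N * blockp pc j 1 * q.
Proof. by rewrite /D /Q blockpS mulrA. Qed.

Lemma expect_degree_le (s : {set 'I_n}) : #|s| = j.+1 ->
  expect (fun t : {set 'I_n} => pc #|t|)
    (fun w => expR (D / 8) * 2^-1 ^+ degree s w) <= expR (- (D / 8)).
Proof.
move=> sj; rewrite expectZ expect_half_degree sj -/Q.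
have [Q0 Q1] : 0 <= Q /\ Q <= 1 by apply/andP; exact: blockp01.
(* The exponent [D / 4] comes from [Q / 2] times [n - j.+1], which is at least [n / 2] by [jn]. *)
apply: (@le_trans _ _ (expR (D / 8) * expR (- (D / 4)))); last first.
  by rewrite -expRD ler_expR; lra.
rewrite ler_wpM2l ?expR_ge0 //.
apply: (@le_trans _ _ (expR (- (Q / 2)) ^+ (n - j.+1))).
  by rewrite lerXn2r ?nnegrE ?expR_ge0 ?expR_ge1Dx // subr_ge0; lra.
rewrite -expRM_natl ler_expR natrB; last by apply: leq_trans jn; rewrite -addnn leq_addr.
have : j.+1%:R * 2 <= N by rewrite -natrM muln2 ler_nat.
by rewrite /D => jN; nra.
Qed.

Lemma Pr_homology_ge (a : nat) : 1 <= D -> K = (2 ^ a)%N ->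
  1 - Pr p (fun Y : {set {set 'I_n}} => forall h : homology Y j, h = 0) <=
  N ^+ j.+1 * ((K.*2.+1 ^ K.*2.+1)%:R * (16 * j.+1%:R) ^+ K.*2 + (K`!)%:R * 8 ^+ K) / D ^+ K.
Proof.
move=> D1 KE; have K0 : (0 < K)%N by rewrite KE expn_gt0.
have Dp : 0 < D by apply: lt_le_trans D1.
(* This makes [B * j.+1%:R] equal to [D / 16], below the degree bound [D / 8]. *)
pose B := D / (16 * j.+1%:R); have Bp : 0 < B by rewrite divr_gt0 // mulr_gt0 // ltr0n.
have BE : B * j.+1%:R = D / 16.
  by rewrite /B invfM mulrA mulfVK // pnatr_eq0.
pose P := fun t : {set 'I_n} => pc #|t|.
rewrite PrE -/pc -/P.
(* Markov's inequality and the union bound in one: the summands are nonnegative and at least [1]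
   when their trace or degree condition fails, so nonzero homology forces [1 <= bad w]. *)
pose bad (w : {set {set 'I_n}}) : R :=
  \sum_(s : {set 'I_n} | #|s| == j) B ^- K.*2 * \tr (linkmx s w q ^+ K.*2) +
  \sum_(s : {set 'I_n} | #|s| == j.+1) expR (D / 8) * 2^-1 ^+ degree s w.
apply: (@le_trans _ _ (expect P bad)).
  rewrite lerBlDr -{1}(expect1 P) -expectD; apply: le_expect => // w.
  have t1 : 0 <= \sum_(s : {set 'I_n} | #|s| == j) B ^- K.*2 * \tr (linkmx s w q ^+ K.*2).
    by apply: sumr_ge0 => s _; rewrite mulr_ge0 ?invr_ge0 ?exprn_ge0 ?mxtrace_linkmx_ge0 // ltW.
  have t2 : 0 <= \sum_(s : {set 'I_n} | #|s| == j.+1) expR (D / 8) * 2^-1 ^+ degree s w.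
    by apply: sumr_ge0 => s _; rewrite mulr_ge0 ?expR_ge0 ?exprn_ge0 // invr_ge0.
  case: asboolP => [_|nh]; first by rewrite lerDr addr_ge0.
  rewrite addr0 leNgt; apply/negP => small; apply: nh.
  have q0 : 0 <= q by case/andP: (blockp01 pc01 j 2).
  apply: (@homology_complex_of_eq0 n r R w j a q B (D / 8)) => //.
  - exact: ltW.
  - by rewrite BE; lra.
  - move=> s sj; rewrite leNgt; apply/negP => dlt.
    move: small; rewrite ltNge => /negP; apply.
    rewrite /bad [X in _ + X](bigD1 s) ?sj //=.
    suff : 1 <= expR (D / 8) * 2^-1 ^+ degree s w.
      move=> h; apply: le_trans h _; rewrite addrCA lerDl addr_ge0 //.
      by apply: sumr_ge0 => u _; rewrite mulr_ge0 ?expR_ge0 ?exprn_ge0 // invr_ge0.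
    rewrite exprVn ler_pdivlMr ?exprn_gt0 // mul1r.
    (* Uses [2 <= expR 1]. *)
    apply: (@le_trans _ _ (expR 1 ^+ degree s w)).
      rewrite lerXn2r ?nnegrE ?expR_ge0 //.
      exact: (expR_ge1Dx (1 : R)).
    by rewrite -expRM_natl mulr1 ler_expR ltW.
  - move=> s sj; rewrite expnS mul2n -KE leNgt; apply/negP => tlt.
    move: small; rewrite ltNge => /negP; apply.
    rewrite /bad (bigD1 s) ?sj //= -addrA.
    suff h : 1 <= B ^- K.*2 * \tr (linkmx s w q ^+ K.*2).
      apply: le_trans h _; rewrite lerDl addr_ge0 //.
      by apply: sumr_ge0 => u _; rewrite mulr_ge0 ?invr_ge0 ?exprn_ge0 ?mxtrace_linkmx_ge0 // ltW.
    by rewrite mulrC ler_pdivlMr ?exprn_gt0 // mul1r ltW.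
rewrite /bad expectD !expect_sum mulrDr mulrDl; apply: lerD.
  apply: (@le_trans _ _ (N ^+ j * (B ^- K.*2 * (N * D ^+ K * (K.*2.+1 ^ K.*2.+1)%:R)))).
    apply: sum_card_le => [|s sj].
      by rewrite !mulr_ge0 ?invr_ge0 ?exprn_ge0 ?ler0n // ltW.
    rewrite expectZ ler_wpM2l ?invr_ge0 ?exprn_ge0 ?(ltW Bp) //.
    rewrite DE -sj; apply: expect_trace_le => //; rewrite ?sj -/q -?DE //.
    apply: le_trans D1 _; rewrite DE -[leRHS]mulr1 ler_wpM2l //.
      by rewrite mulr_ge0 ?ler0n //; case/andP: (blockp01 pc01 j 1).
    by case/andP: (blockp01 pc01 j 2).
  rewrite le_eqVlt; apply/orP; left; apply/eqP.
  (* Here [B ^- K.*2] supplies [D ^- K.*2], of which the trace bound takes back only [D ^+ K]. *)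
  have cK : B ^- K.*2 = (16 * j.+1%:R) ^+ K.*2 / (D ^+ K * D ^+ K).
    by rewrite -exprD addnn /B exprMn exprVn invf_div.
  rewrite cK exprSr; set c := _ ^+ K.*2; have Dk : D ^+ K != 0 by rewrite gt_eqF ?exprn_gt0.
  by field.
apply: (@le_trans _ _ (N ^+ j.+1 * ((K`!)%:R / (D / 8) ^+ K))).
  apply: sum_card_le => [|s sj].
    by rewrite divr_ge0 ?ler0n ?exprn_ge0 ?divr_ge0 // ltW.
  by apply: le_trans (expect_degree_le sj) _; apply: expRN_le => //; rewrite divr_gt0.
by rewrite exprMn exprVn invfM invrK -!mulrA [_^-1 * 8 ^+ K]mulrC.
Qed.

End TailBound.

(** * Asymptotics of the parameters *)

(** The exponents of [n] add up to [- psi m a]; indices above [m] have binomial coefficient [0], so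
    the product may run up to [r]. *)
Lemma blockp_powR (R : realType) (r m n : nat) (a : 'rV[R]_r.+1) :
  (m <= r)%N -> (0 < n)%N ->
  n%:R * blockp (face_prob (fun i => n%:R `^ (- a ord0 i))) m 1 = n%:R `^ (1 - psi m a).
Proof.
move=> mr n0; have nn : (n%:R : R) != 0 by rewrite pnatr_eq0 -lt0n.
have pD (x y : R) : n%:R `^ (x + y) = n%:R `^ x * n%:R `^ y :> R.
  by rewrite powRD // nn implybT.
rewrite pD powRr1 ?ler0n //; congr (_ * _).
have -> : n%:R `^ (- psi m a) = \prod_(i < r.+1) n%:R `^ (- a ord0 i) ^+ 'C(m, i) :> R.
  rewrite /psi -sumrN.
  rewrite (big_morph _ pD (powRr0 _)); apply: eq_bigr => i _.
  by rewrite -powR_mulrn ?powR_ge0 // -powRrM mulNr mulrC.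
rewrite /blockp.
rewrite (big_ord_widen r.+1
  (fun i => face_prob (fun i => n%:R `^ (- a ord0 i)) (i + 1) ^+ 'C(m, i))) //.
rewrite [in LHS]big_mkcond; apply: eq_bigr => i _; rewrite addn1 face_prob_ord.
by case: ifPn => //; rewrite -leqNgt => mi; rewrite bin_small.
Qed.

Lemma cvg_psi (R : realType) (r m : nat) (alpha : nat -> 'rV[R]_r.+1) (a : 'rV[R]_r.+1) :
  alpha n @[n --> \oo] --> a -> psi m (alpha n) @[n --> \oo] --> psi m a.
Proof.
move=> cv; rewrite /psi; apply: cvg_big => [|i _].
  exact: add_continuous.
apply: cvgM; first exact: cvg_cst.
have := @continuous_cvg _ _ _ _ _ alpha (fun M : 'rV[R]_r.+1 => M ord0 i) a _ cv.
by apply; exact: coord_continuous.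
Qed.

Lemma le_psi (R : realType) (r k l : nat) (a : 'rV[R]_r.+1) :
  (forall i, 0 <= a ord0 i) -> (k <= l)%N -> psi k a <= psi l a.
Proof.
move=> a0 kl; apply: ler_sum => i _.
by rewrite ler_wpM2r // ler_nat leq_bin2l.
Qed.

Theorem theorem13 (R : realType) (r k : nat)
    (alpha : nat -> 'rV[R]_r.+1) (alphastar : 'rV[R]_r.+1)
    (hk2 : (2 <= k)%N) (hkr : (k <= r)%N)
    (halpha : forall (n : nat) (i : 'I_r.+1), 0 <= alpha n ord0 i)
    (hstar : domain k alphastar)
    (hcvg : alpha n @[n --> \oo] --> alphastar) :
  forall j : nat, (0 < j)%N -> (j <= k - 1)%N ->
    aas (fun (n : nat) (i : 'I_r.+1) => n%:R `^ (- alpha n ord0 i))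
        (fun (n : nat) (Y : {set {set 'I_n}}) =>
           forall h : homology Y j, h = 0).
Proof.
move=> j j0 jk1; have jk : (j < k)%N by rewrite -(subnK (ltnW hk2)) addn1 ltnS.
have [a0 psik _] := hstar.
(* Half of the gap below [1], so that [psi j.+1 (alpha n) <= 1 - e] eventually. *)
pose e : R := (1 - psi j.+1 alphastar) / 2.
have psij : psi j.+1 alphastar < 1 := le_lt_trans (le_psi a0 jk) psik.
have e0 : 0 < e by rewrite divr_gt0 // subr_gt0.
(* With [K = 2 ^ a], the power [n ^ (e * K)] beats the factor [n ^ j.+1] of the union bound by at
   least one more factor [n]. *)
have [a ae] : exists a : nat, j.+2%:R <= e * (2 ^ a)%:R.
  exists (Num.truncn (j.+2%:R / e)).+1.
  rewrite mulrC -ler_pdivrMr //; apply: (le_trans (ltW (truncnS_gt _))).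
  by rewrite ler_nat ltnW // ltn_expl.
pose K := (2 ^ a)%N.
pose C : R := (K.*2.+1 ^ K.*2.+1)%:R * (16 * j.+1%:R) ^+ K.*2 + (K`!)%:R * 8 ^+ K.
have C0 : 0 <= C by rewrite addr_ge0 ?mulr_ge0 ?exprn_ge0 ?ler0n.
rewrite /aas; apply/cvgrPdist_le => eps eps0.
have near_psi : \forall n \near \oo, psi j.+1 (alpha n) <= 1 - e.
  apply: (cvgr_le _ (cvg_psi (m := j.+1) hcvg)).
  by rewrite /e; lra.
near=> n.
have n0 : (0 < n)%N.
  near: n; exact: nbhs_infty_gt.
have p01 i : 0 <= (n%:R `^ (- alpha n ord0 i) : R) <= 1.
  rewrite powR_ge0 /= -[leRHS](powRr0 n%:R); apply: ler_powR; first by rewrite ler1n.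
  by rewrite oppr_le0.
have DE := blockp_powR (alpha n) (leq_trans jk hkr) n0.
set D : R := n%:R * _ in DE.
have De : n%:R `^ e <= D.
  rewrite DE; apply: ler_powR; first by rewrite ler1n.
  rewrite lerBrDr addrC -lerBrDr; near: n; exact: near_psi.
have D1 : 1 <= D.
  apply: le_trans De; rewrite -[leLHS](powRr0 n%:R); apply: ler_powR; rewrite ?ler1n //.
  exact: ltW.
have DK : n%:R ^+ j.+2 <= D ^+ K.
  apply: (@le_trans _ _ ((n%:R `^ e) ^+ K)); last first.
    by rewrite lerXn2r // nnegrE ?powR_ge0 // (le_trans ler01).
  rewrite -!powR_mulrn ?powR_ge0 ?ler0n // -powRrM; apply: ler_powR => //.
  by rewrite ler1n.
have jn : (j.+1.*2 <= n)%N by near: n; exact: nbhs_infty_ge.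
have := Pr_homology_ge p01 j0 (leq_trans jk hkr) jn D1 (erefl K).
rewrite -/C -/D => Prge.
have Pr1 : Pr (fun i : 'I_r.+1 => n%:R `^ (- alpha n ord0 i))
   (fun Y : {set {set 'I_n}} => forall h : homology Y j, h = 0) <= 1.
  rewrite PrE -[leRHS](expect1 (fun t : {set 'I_n} =>
     face_prob (fun i : 'I_r.+1 => n%:R `^ (- alpha n ord0 i) : R) #|t|)).
  apply: le_expect => [t|w].
    by rewrite /face_prob; case: ifP => _; rewrite ?lexx ?ler01.
  by case: asboolP.
rewrite ger0_norm ?subr_ge0 //; apply: (le_trans Prge).
(* The failure probability is now at most [C / n], with [C] independent of [n]. *)
apply: (@le_trans _ _ (n%:R ^+ j.+1 * C / n%:R ^+ j.+2)).
  rewrite ler_wpM2l ?mulr_ge0 ?exprn_ge0 ?ler0n // lef_pV2 ?posrE ?exprn_gt0 ?ltr0n //.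
  exact: lt_le_trans D1.
have np : 0 < n%:R :> R by rewrite ltr0n.
have -> : n%:R ^+ j.+1 * C / n%:R ^+ j.+2 = C / n%:R :> R.
  rewrite [_ ^+ j.+2]exprS; have nj : n%:R ^+ j.+1 != 0 :> R by rewrite gt_eqF ?exprn_gt0.
  by rewrite invfM [n%:R ^+ j.+1 * C]mulrC mulrACA mulfV // mulr1.
rewrite ler_pdivrMr // mulrC -ler_pdivrMr //.
near: n; exact: nbhs_infty_ger.
Unshelve. all: by end_near.
Qed.
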